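(* Assume $\max A=b-1$ and let $s\in\mathbb{C}$ with $\operatorname{Re}s>\log_bN$. Then, as the real variable $m\to+\infty$, $$m^s u_m(s)=F_s(m)+O\!\left(\frac1m\right),$$ where $$F_s(m)=\frac{1}{\log b}\sum_{k=-\infty}^{\infty}e^{2\pi i k\log_b(m)}\,\Gamma\!\Bigl(s-\frac{2\pi i k}{\log b}\Bigr)\sum_{n\in\mathcal{B}}\frac{1}{(n+1)^{\,s-\frac{2\pi i k}{\log b}}}$$ is a smooth $1$-periodic function of $\log_b(m)$ (so $F_s(bm)=F_s(m)$), which can equivalently be written as $$F_s(m)=m^s\sum_{j=-\infty}^{\infty}b^{js}e^{-b^jm}\sum_{n\in\mathcal{B}}e^{-nb^jm}.$$ Moreover, for the integer moments, the asymptotic average exists and equals $$\lim_{p\to\infty}\ \sum_{\substack{m\in\mathbb{Z}\\ b^p<m\le b^{p+1}}} m^s u_m(s)\,\log_b\!\frac{m}{m-1}=\frac{\Gamma(s)}{\log b}\sum_{n\in\mathcal{B}}\frac{1}{(n+1)^s}.$$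
   Context: Let $b\ge 2$ be an integer and $A\subset\{0,1,\dots,b-1\}$ a nonempty set of digits with $N=\#A$ and $f=\max A>0$. For $s\in\mathbb{C}$ with $\operatorname{Re}s>\log_b N$, $\mu_s$ is the discrete complex Borel measure on $[0,1)$ $$\mu_s=\delta_0+\sum_{l=1}^{\infty}\ \sum_{(a_1,\dots,a_l)\in A^l} b^{-ls}\,\delta_{a_1b^{-1}+\cdots+a_lb^{-l}},$$ where $\delta_y$ denotes the unit Dirac mass at $y$, and for real $m\ge0$ its moments are $$u_m(s)=\int_{[0,1)}x^m\,\mu_s(dx)=0^m+\sum_{l=1}^\infty\sum_{(a_1,\dots,a_l)\in A^l}\bigl(a_1b^{-1}+\cdots+a_lb^{-l}\bigr)^m b^{-ls}\quad(0^0=1).$$ Let $B=\{f-a: a\in A\}$ and let $\mathcal{B}$ be the set of non-negative integers whose radix-$b$ representation uses only digits from $B$ (the integer $0$, represented by the empty word, always belongs to $\mathcal{B}$). Powers $m^s$, $(n+1)^w$ use the principal branch $e^{s\log m}$, and $\Gamma$ is Euler's Gamma function. *)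

(* Defs.v *)
From Stdlib Require Import Reals Lra Lia List ClassicalEpsilon.
From Coquelicot Require Import Coquelicot.
Import ListNotations.
Open Scope R_scope.

(* Complex power x^z for a positive real base x, principal branch
   e^{z log x}.  (Only used with x > 0; value 0 otherwise.) *)
Definition cpow (x : R) (z : C) : C :=
  if Rlt_dec 0 x then
    (exp (Re z * ln x) * cos (Im z * ln x), exp (Re z * ln x) * sin (Im z * ln x))
  else 0%C.

Definition cis (t : R) : C := (cos t, sin t).

Definition rpow0 (x m : R) : R :=
  if Req_EM_T x 0 then (if Req_EM_T m 0 then 1 else 0) else Rpower x m.

(* Sum of a complex series (componentwise; 0-ish value if divergent). *)
Definition CSeries (a : nat -> C) : C :=
  (Series (fun n => Re (a n)), Series (fun n => Im (a n))).

Definition csum (l : list C) : C := fold_right Cplus 0%C l.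

Definition is_zsum (a : Z -> C) (l : C) : Prop :=
  exists l1 l2 : C,
    is_series (fun k : nat => a (Z.of_nat k)) l1 /\
    is_series (fun k : nat => a (- Z.of_nat (S k))%Z) l2 /\
    l = (l1 + l2)%C.

Definition fmax (A : list nat) : nat := fold_right Nat.max 0%nat A.

Fixpoint words (A : list nat) (l : nat) : list (list nat) :=
  match l with
  | O => [ [] ]
  | S l' => flat_map (fun a => map (cons a) (words A l')) A
  end.

(* x_w = a_1 b^{-1} + ... + a_l b^{-l} *)
Fixpoint xval (b : nat) (w : list nat) : R :=
  match w with
  | [] => 0
  | a :: w' => (INR a + xval b w') / INR b
  end.

Definition umom (b : nat) (A : list nat) (s : C) (m : R) : C :=
  (RtoC (rpow0 0 m) +
   CSeries (fun l : nat =>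
     csum (map (fun w => (RtoC (rpow0 (xval b w) m) *
                          cpow (INR b) (- (RtoC (INR (S l)) * s)))%C)
               (words A (S l)))))%C.

(* n belongs to the set \mathcal{B}: every radix-b digit of n lies in
   B = { f - a : a in A }, f = max A.  (0, with empty representation, is in.) *)
Definition inB (b : nat) (A : list nat) (n : nat) : Prop :=
  forall i : nat, (n / b ^ i <> 0)%nat ->
    exists a, In a A /\ ((n / b ^ i) mod b = fmax A - a)%nat.

Definition indB (b : nat) (A : list nat) (n : nat) : R :=
  if excluded_middle_informative (inB b A n) then 1 else 0.

Definition sumB (b : nat) (A : list nat) (w : C) : C :=
  CSeries (fun n => (RtoC (indB b A n) * cpow (INR n + 1) (- w))%C).

Definition CGamma (z : C) : C :=
  @RInt_gen C_R_CompleteNormedModule (fun t : R => (cpow t (z - 1) * RtoC (exp (- t)))%C)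
           (at_right 0) (Rbar_locally p_infty).

(* Main.v *)
(** Complementing digits, a -> b - 1 - a, turns the words of length l over A into the
    elements n < b^l of the digit set B, with x_w = 1 - (n + 1) / b^l; hence
    m^s u_m(s) = sum_(l >= 0) (m b^-l)^s sum_(n in B, n < b^l) (1 - (n + 1) / b^l)^m.
    Replacing (1 - y)^m by e^(-m y) costs at most m y^2 e^(-m y) = (m y)^2 e^(-m y) / m,
    also for y > 1 where the first term is absent, so extending the sums to all n in B and
    all l in Z changes the value by at most 1/m times a bounded function periodic in
    log_b m.  With t = log_b m the limit is the periodization sum_(j in Z) Phi (t + j) of
    Phi t = b^(s t) sum_(n in B) e^(-(n + 1) b^t), which decays exponentially at both ends.
    Its Fourier coefficients are the integrals of Phi over the line: exchanging sum and
    integral and translating each term by log_b (n + 1) leaves Gamma times the Dirichlet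
    series.  The average of the moments is a Riemann sum for the mean over a period. *)

Require Import Defs.
From Stdlib Require Import Reals Lra Lia List ZArith ClassicalEpsilon.
From Coquelicot Require Import Coquelicot.
Import ListNotations.
Open Scope R_scope.

(** * Integrals and locally dominated series *)

(** Two obstacles shape the proof. [is_zsum] asks each half of a bilateral sum to converge by
    itself, whereas Fourier series are usually summed symmetrically; so the conjugate sine series
    must converge as well, and Chernoff's argument is carried out for both kernels. Moreover all
    integrals are Riemann integrals: exchanges of sum and integral rest on summable majorants, and
    the integral over the line is defined as the integral of the periodization over one period,
    which makes the unfolding of Fourier coefficients immediate. Only Gamma calls for a comparison
    with an improper integral. Complex quantities are split into real and imaginary parts. One
    family of real profiles, obtained from the moduli of the terms of Phi by inserting ((n + 1)
    b^t)^i, serves twice: it is closed under differentiation in t, which gives smoothness, and its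
    member i = 2 is the error (m y)^2 e^(-m y). *)

Definition psum (f : nat -> R) (N : nat) : R := sum_n f N.

Lemma psum_O f : psum f 0 = f 0%nat.
Proof. apply sum_O. Qed.

Lemma psum_Sn f N : psum f (S N) = psum f N + f (S N).
Proof. exact (sum_Sn f N). Qed.

Lemma psum_Reals f N : psum f N = sum_f_R0 f N.
Proof. apply sum_n_Reals. Qed.

Definition cont (f : R -> R) : Prop := forall t, continuous f t.

Lemma continuous_eps (f : R -> R) (x : R) :
  continuous f x <->
  forall eps, 0 < eps -> exists d, 0 < d /\
    forall y, Rabs (y - x) < d -> Rabs (f y - f x) < eps.
Proof.
split.
- intros H eps He.
  destruct (proj1 (filterlim_locally f (f x)) H (mkposreal eps He)) as [d Hd].
  exists d; split; [apply cond_pos|]. intros y Hy; exact (Hd y Hy).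
- intros H; apply filterlim_locally; intros eps.
  destruct (H eps (cond_pos eps)) as [d [Hd0 Hd]].
  exists (mkposreal d Hd0); intros y Hy; exact (Hd y Hy).
Qed.

Lemma cont_plus f g : cont f -> cont g -> cont (fun t => f t + g t).
Proof. intros Hf Hg t; exact (continuous_plus f g t (Hf t) (Hg t)). Qed.

Lemma cont_mult f g : cont f -> cont g -> cont (fun t => f t * g t).
Proof. intros Hf Hg t; exact (continuous_mult f g t (Hf t) (Hg t)). Qed.

Lemma cont_const c : cont (fun _ => c).
Proof. intros t; apply continuous_const. Qed.

Lemma cont_scal c f : cont f -> cont (fun t => c * f t).
Proof. intros Hf; apply cont_mult; [apply cont_const|exact Hf]. Qed.

Lemma cont_comp f g : cont f -> cont g -> cont (fun t => f (g t)).
Proof. intros Hf Hg t; apply continuous_comp; [apply Hg|apply Hf]. Qed.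

Lemma cont_derive f g : (forall t, is_derive f t (g t)) -> cont f.
Proof. intros H t; apply (ex_derive_continuous f t); exists (g t); apply H. Qed.

Lemma cont_psum (f : nat -> R -> R) N :
  (forall n, cont (f n)) -> cont (fun t => psum (fun n => f n t) N).
Proof.
intros H; induction N as [|N IH].
- intros t; apply continuous_ext with (f 0%nat); [|apply H].
  intros x; now rewrite psum_O.
- intros t; apply continuous_ext with (fun x => psum (fun n => f n x) N + f (S N) x).
  + intros x; now rewrite psum_Sn.
  + exact (cont_plus _ _ IH (H (S N)) t).
Qed.

Lemma cont_ex_RInt f a b : cont f -> ex_RInt f a b.
Proof. intros H; apply (@ex_RInt_continuous R_CompleteNormedModule); intros z _; apply H. Qed.

Lemma RInt_Rplus f g a b : cont f -> cont g ->
  RInt (fun x => f x + g x) a b = RInt f a b + RInt g a b.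
Proof. intros Hf Hg; exact (RInt_plus f g a b (cont_ex_RInt _ _ _ Hf) (cont_ex_RInt _ _ _ Hg)). Qed.

Lemma RInt_Rminus f g a b : cont f -> cont g ->
  RInt (fun x => f x - g x) a b = RInt f a b - RInt g a b.
Proof. intros Hf Hg; exact (RInt_minus f g a b (cont_ex_RInt _ _ _ Hf) (cont_ex_RInt _ _ _ Hg)). Qed.

Lemma RInt_Rscal c f a b : cont f -> RInt (fun x => c * f x) a b = c * RInt f a b.
Proof. intros Hf; exact (RInt_scal f a b c (cont_ex_RInt _ _ _ Hf)). Qed.

Lemma RInt_shift f c a b : cont f ->
  RInt (fun x => f (x + c)) a b = RInt f (a + c) (b + c).
Proof.
intros Hf.
assert (H := RInt_comp_lin f 1 c a b (cont_ex_RInt _ _ _ Hf)).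
rewrite !Rmult_1_l in H; rewrite <- H.
apply RInt_ext; intros x _; unfold scal; simpl; unfold mult; simpl.
now rewrite !Rmult_1_l.
Qed.

Lemma RInt_split f a b c : cont f -> RInt f a b + RInt f b c = RInt f a c.
Proof. intros Hf; exact (RInt_Chasles f a b c (cont_ex_RInt _ _ _ Hf) (cont_ex_RInt _ _ _ Hf)). Qed.

Lemma RInt_abs_bound f a b M : cont f ->
  (forall t, Rmin a b <= t <= Rmax a b -> Rabs (f t) <= M) ->
  Rabs (RInt f a b) <= Rabs (b - a) * M.
Proof.
intros Hf HM; destruct (Rle_dec a b) as [Hab|Hab].
- rewrite (Rabs_pos_eq (b - a)) by lra.
  apply abs_RInt_le_const; [lra|now apply cont_ex_RInt|].
  intros t Ht; apply HM; rewrite Rmin_left, Rmax_right; lra.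
- assert (Hs : RInt f a b = - RInt f b a).
  { generalize (RInt_split f a b a Hf). rewrite RInt_point; unfold zero; simpl; lra. }
  rewrite Hs, Rabs_Ropp, (Rabs_left (b - a)) by lra.
  replace (- (b - a)) with (a - b) by ring.
  apply abs_RInt_le_const; [lra|now apply cont_ex_RInt|].
  intros t Ht; apply HM; rewrite Rmin_right, Rmax_left; lra.
Qed.

Lemma RInt_psum (f : nat -> R -> R) a b N : (forall n, cont (f n)) ->
  RInt (fun t => psum (fun n => f n t) N) a b = psum (fun n => RInt (f n) a b) N.
Proof.
intros H; induction N as [|N IH].
- rewrite psum_O; apply RInt_ext; intros; now rewrite psum_O.
- rewrite psum_Sn, <- IH.
  transitivity (RInt (fun t => psum (fun n => f n t) N + f (S N) t) a b).
  + apply RInt_ext; intros; now rewrite psum_Sn.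
  + apply RInt_Rplus; [now apply cont_psum|apply H].
Qed.

Lemma ex_series_dom (f a : nat -> R) :
  (forall n, Rabs (f n) <= a n) -> ex_series a -> ex_series f.
Proof. intros H Ha; exact (@ex_series_le R_AbsRing R_CompleteNormedModule f a H Ha). Qed.

Lemma Series_abs_le (f a : nat -> R) :
  (forall n, Rabs (f n) <= a n) -> ex_series a -> Rabs (Series f) <= Series a.
Proof.
intros H Ha.
eapply Rle_trans; [apply Series_Rabs; apply ex_series_dom with a; [|exact Ha]|].
- intros n; rewrite Rabs_Rabsolu; apply H.
- apply Series_le; [|exact Ha]; intros n; split; [apply Rabs_pos|apply H].
Qed.

Lemma Series_tail (a : nat -> R) N : ex_series a ->
  Series a - psum a N = Series (fun k => a (S N + k)%nat).
Proof.
intros Ha; rewrite (Series_incr_n a (S N)); [|lia|exact Ha].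
rewrite psum_Reals; simpl; ring.
Qed.

Lemma Series_tail_le (f a : nat -> R) N :
  (forall n, Rabs (f n) <= a n) -> ex_series a ->
  Rabs (Series f - psum f N) <= Series a - psum a N.
Proof.
intros H Ha; rewrite !Series_tail; [|exact Ha|now apply ex_series_dom with a].
apply Series_abs_le; [intros; apply H|].
now apply (ex_series_incr_n a (S N)).
Qed.

Lemma is_series_eps (a : nat -> R) l :
  is_series a l <->
  forall eps, 0 < eps -> exists N, forall n, (N <= n)%nat -> Rabs (psum a n - l) < eps.
Proof.
split.
- intros H eps He.
  destruct (proj1 (filterlim_locally (sum_n a) l) H (mkposreal eps He)) as [N HN].
  exists N; intros n Hn; exact (HN n Hn).
- intros H; apply filterlim_locally; intros eps.
  destruct (H eps (cond_pos eps)) as [N HN]; exists N; intros n Hn; exact (HN n Hn).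
Qed.

Lemma Series_tail_small (a : nat -> R) : ex_series a ->
  forall eps, 0 < eps -> exists N, forall n, (N <= n)%nat -> Rabs (Series a - psum a n) < eps.
Proof.
intros Ha eps He.
destruct (proj1 (is_series_eps a _) (Series_correct a Ha) eps He) as [N HN].
exists N; intros n Hn; rewrite Rabs_minus_sym; now apply HN.
Qed.

(** Weierstrass majorants, allowed to depend on the bounded interval: enough for continuity and for
    integrals over compact intervals. *)
Definition locdom (f : nat -> R -> R) : Prop :=
  forall T, exists a, ex_series a /\ forall n t, Rabs t <= T -> Rabs (f n t) <= a n.

Lemma locdom_ex f t : locdom f -> ex_series (fun n => f n t).
Proof.
intros H; destruct (H (Rabs t)) as [a [Ha Hb]].
apply ex_series_dom with a; [|exact Ha]; intros n; apply Hb; lra.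
Qed.

Lemma Series_cont f : locdom f -> (forall n, cont (f n)) ->
  cont (fun t => Series (fun n => f n t)).
Proof.
intros Hd Hc t; apply continuous_eps; intros eps He.
destruct (Hd (Rabs t + 1)) as [a [Ha Hb]].
destruct (Series_tail_small a Ha (eps / 3)) as [N HN]; [lra|].
specialize (HN N (le_n N)).
destruct (proj1 (continuous_eps _ t) (cont_psum f N Hc t) (eps / 3)) as [d [Hd0 Hd1]]; [lra|].
exists (Rmin d 1); split; [apply Rmin_glb_lt; lra|].
intros y Hy.
assert (Hy1 : Rabs (y - t) < d) by (eapply Rlt_le_trans; [apply Hy|apply Rmin_l]).
assert (Hy2 : Rabs (y - t) < 1) by (eapply Rlt_le_trans; [apply Hy|apply Rmin_r]).
assert (Hy3 : Rabs y <= Rabs t + 1).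
{ replace y with (t + (y - t)) by ring; eapply Rle_trans; [apply Rabs_triang|lra]. }
assert (Ty : Rabs (Series (fun n => f n y) - psum (fun n => f n y) N) <= Series a - psum a N)
  by (apply Series_tail_le; [intros n; now apply Hb|exact Ha]).
assert (Tt : Rabs (Series (fun n => f n t) - psum (fun n => f n t) N) <= Series a - psum a N)
  by (apply Series_tail_le; [intros n; apply Hb; lra|exact Ha]).
specialize (Hd1 y Hy1).
apply Rabs_def2 in HN; apply Rabs_def2 in Hd1; apply Rabs_le_between in Ty, Tt.
apply Rabs_def1; lra.
Qed.

Lemma RInt_Series f a b : locdom f -> (forall n, cont (f n)) ->
  is_series (fun n => RInt (f n) a b) (RInt (fun t => Series (fun n => f n t)) a b).
Proof.
intros Hd Hc; apply is_series_eps; intros eps He.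
destruct (Hd (Rmax (Rabs a) (Rabs b))) as [u [Hu Hb]].
(* The added 1 keeps the divisor positive when [a = b]. *)
destruct (Series_tail_small u Hu (eps / (Rabs (b - a) + 1))) as [N HN].
{ apply Rdiv_lt_0_compat; [exact He|]; generalize (Rabs_pos (b - a)); lra. }
exists N; intros n Hn; specialize (HN n Hn).
rewrite <- RInt_psum by exact Hc.
rewrite <- RInt_Rminus; [|now apply cont_psum|now apply Series_cont].
set (e := eps / (Rabs (b - a) + 1)) in *.
assert (He' : eps = e * (Rabs (b - a) + 1))
  by (unfold e; field; generalize (Rabs_pos (b - a)); lra).
assert (He0 : 0 < e) by (eapply Rle_lt_trans; [apply Rabs_pos|exact HN]).
apply Rle_lt_trans with (Rabs (b - a) * e).
- apply RInt_abs_bound.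
  + apply cont_plus; [now apply cont_psum|].
    intros t; apply (continuous_opp (fun t => Series (fun n => f n t)) t);
    now apply Series_cont.
  + intros t Ht; rewrite Rabs_minus_sym; eapply Rle_trans.
    * apply Series_tail_le; [|exact Hu]; intros k; apply Hb.
      unfold Rmin, Rmax in Ht |- *; unfold Rabs;
      repeat match goal with |- context [Rcase_abs ?x] => destruct (Rcase_abs x) end;
      repeat match goal with |- context [Rle_dec ?x ?y] => destruct (Rle_dec x y) end;
      destruct (Rle_dec a b); lra.
    * apply Rabs_def2 in HN; lra.
- rewrite He'; nra.
Qed.

(** Integrating the derivatives termwise from 0 recovers the series up to a constant, and the
    fundamental theorem of calculus concludes. *)
Lemma Series_is_derive f g : locdom f -> locdom g -> (forall n, cont (g n)) ->
  (forall n t, is_derive (f n) t (g n t)) ->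
  forall t, is_derive (fun t => Series (fun n => f n t)) t (Series (fun n => g n t)).
Proof.
intros Hf Hg Hc Hd t.
set (G := fun t => Series (fun n => g n t)).
assert (HG : cont G) by now apply Series_cont.
apply is_derive_ext with (fun x => Series (fun n => f n 0) + RInt G 0 x).
- intros x.
  assert (Hi : is_series (fun n => f n x - f n 0) (RInt G 0 x)).
  { apply is_series_ext with (2 := RInt_Series g 0 x Hg Hc).
    intros n; apply is_RInt_unique.
    apply (is_RInt_derive (V := R_CompleteNormedModule) (f n) (g n) 0 x);
      intros; [apply Hd|apply Hc]. }
  apply is_series_unique in Hi; rewrite <- Hi, <- Series_plus.
  + apply Series_ext; intros; ring.
  + now apply locdom_ex.
  + apply (ex_series_minus (V := R_NormedModule)); now apply locdom_ex.
- evar_last.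
  + apply @is_derive_plus; [apply is_derive_const|].
    apply (is_derive_RInt G _ 0); [|apply HG].
    exists (mkposreal 1 Rlt_0_1); intros y _.
    apply (RInt_correct (V := R_CompleteNormedModule)); now apply cont_ex_RInt.
  + unfold plus, zero; simpl; unfold G; ring.
Qed.

(** * Exponentially decaying functions and their periodizations *)

Lemma exp_INR x n : exp (x * INR n) = exp x ^ n.
Proof.
induction n as [|n IH]; [now rewrite Rmult_0_r, exp_0|].
rewrite S_INR, Rmult_plus_distr_l, Rmult_1_r, exp_plus, IH; simpl; ring.
Qed.

Lemma ex_series_exp e : 0 < e -> ex_series (fun n => exp (- e * INR n)).
Proof.
intros He; apply ex_series_ext with (fun n => exp (- e) ^ n).
- intros n; now rewrite exp_INR.
- apply ex_series_geom; rewrite Rabs_pos_eq by (left; apply exp_pos).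
  rewrite <- exp_0; apply exp_increasing; lra.
Qed.

Lemma exp_le_compat x y : x <= y -> exp x <= exp y.
Proof. intros [H|H]; [left; now apply exp_increasing|right; now rewrite H]. Qed.

Lemma exp_small K e eps : 0 <= K -> 0 < e -> 0 < eps ->
  exists M, 0 <= M /\ K * exp (- e * M) < eps.
Proof.
intros HK He Heps; exists (K / eps / e).
assert (H0 : 0 <= K / eps / e).
{ apply Rdiv_le_0_compat; [apply Rdiv_le_0_compat; lra|exact He]. }
split; [exact H0|].
replace (- e * (K / eps / e)) with (- (K / eps)) by (field; lra).
rewrite exp_Ropp.
assert (H1 : 1 + K / eps <= exp (K / eps)).
{ destruct (Req_dec (K / eps) 0) as [->|Hn]; [rewrite exp_0; lra|left; now apply exp_ineq1]. }
assert (H2 : K = eps * (K / eps)) by (field; lra).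
assert (H3 := exp_pos (K / eps)).
apply Rmult_lt_reg_r with (exp (K / eps)); [exact H3|].
rewrite Rmult_assoc, Rinv_l, Rmult_1_r by lra. nra.
Qed.

(** A class whose periodizations converge locally uniformly and which is stable under sums,
    translations and bounded continuous factors. *)
Definition expdec (f : R -> R) : Prop :=
  cont f /\ exists C e, 0 <= C /\ 0 < e /\ forall t, Rabs (f t) <= C * exp (- e * Rabs t).

Lemma expdec_plus f g : expdec f -> expdec g -> expdec (fun t => f t + g t).
Proof.
intros [Hf [C [e [HC [He Hb]]]]] [Hg [C' [e' [HC' [He' Hb']]]]].
split; [now apply cont_plus|].
exists (C + C'), (Rmin e e'); split; [lra|split; [now apply Rmin_glb_lt|]].
intros t; eapply Rle_trans; [apply Rabs_triang|].
rewrite Rmult_plus_distr_r; specialize (Hb t); specialize (Hb' t).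
assert (H := Rabs_pos t).
apply Rplus_le_compat; (eapply Rle_trans; [eassumption|]);
  apply Rmult_le_compat_l; try lra; apply exp_le_compat;
  generalize (Rmin_l e e') (Rmin_r e e'); nra.
Qed.

Lemma expdec_mult f p M : expdec f -> cont p -> (forall t, Rabs (p t) <= M) ->
  expdec (fun t => f t * p t).
Proof.
intros [Hf [C [e [HC [He Hb]]]]] Hp HM.
split; [now apply cont_mult|].
assert (0 <= M) by (eapply Rle_trans; [apply Rabs_pos|apply (HM 0)]).
exists (C * M), e; split; [nra|split; [exact He|]].
intros t; rewrite Rabs_mult.
replace (C * M * exp (- e * Rabs t)) with ((C * exp (- e * Rabs t)) * M) by ring.
apply Rmult_le_compat; auto using Rabs_pos.
Qed.

Lemma expdec_ext f g : (forall t, f t = g t) -> expdec f -> expdec g.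
Proof.
intros E [Hc [C [e [HC [He Hb]]]]]; split.
- intros t; apply continuous_ext with f; [exact E|apply Hc].
- exists C, e; repeat split; trivial; intros t; rewrite <- E; apply Hb.
Qed.

Lemma expdec_scal c f : expdec f -> expdec (fun t => c * f t).
Proof.
intros H; apply expdec_ext with (fun t => f t * c); [intros; ring|].
apply expdec_mult with (Rabs c); [exact H|apply cont_const|intros; lra].
Qed.

Lemma expdec_shift f c : expdec f -> expdec (fun t => f (t + c)).
Proof.
intros [Hc [C [e [HC [He Hb]]]]]; split.
- apply (cont_comp f (fun t => t + c)); [exact Hc|].
  apply cont_plus; [intros t; apply continuous_id|apply cont_const].
- exists (C * exp (e * Rabs c)), e; split; [|split; [exact He|]].
  { apply Rmult_le_pos; [exact HC|left; apply exp_pos]. }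
  intros t; eapply Rle_trans; [apply Hb|].
  rewrite Rmult_assoc, <- exp_plus; apply Rmult_le_compat_l; [exact HC|].
  apply exp_le_compat.
  assert (Rabs t <= Rabs (t + c) + Rabs c).
  { replace t with ((t + c) + - c) at 1 by ring; rewrite <- (Rabs_Ropp c); apply Rabs_triang. }
  nra.
Qed.

(** Periodization, cut between the shifts 0 and -1 exactly as in [is_zsum]. *)
Definition Per (f : R -> R) (t : R) : R :=
  Series (fun n => f (t + INR n)) + Series (fun n => f (t - INR (S n))).

Definition periodic (f : R -> R) : Prop := forall t, f (t + 1) = f t.

(** For |t| <= T the argument has modulus at least n - T, which costs only the constant factor e^(e
    T). *)
Lemma locdom_shift f (x : nat -> R) :
  expdec f -> (forall n, INR n <= Rabs (x n)) -> locdom (fun n t => f (t + x n)).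
Proof.
intros [_ [C [e [HC [He Hb]]]]] Hx T.
exists (fun n => C * exp (e * T) * exp (- e * INR n)); split.
- apply (ex_series_scal (V := R_NormedModule)); now apply ex_series_exp.
- intros n t Ht; eapply Rle_trans; [apply Hb|].
  rewrite Rmult_assoc, <- exp_plus; apply Rmult_le_compat_l; [exact HC|].
  apply exp_le_compat.
  assert (Rabs (x n) <= Rabs (t + x n) + Rabs t).
  { replace (x n) with ((t + x n) + - t) at 1 by ring; rewrite <- (Rabs_Ropp t); apply Rabs_triang. }
  specialize (Hx n); nra.
Qed.

Lemma locdom_up f : expdec f -> locdom (fun n t => f (t + INR n)).
Proof.
intros H; apply (locdom_shift f INR); [exact H|].
intros n; rewrite Rabs_pos_eq; [lra|apply pos_INR].
Qed.

Lemma locdom_dn f : expdec f -> locdom (fun n t => f (t - INR (S n))).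
Proof.
intros H; apply (locdom_shift f (fun n => - INR (S n))); [exact H|].
intros n; rewrite Rabs_Ropp, Rabs_pos_eq; [rewrite S_INR; lra|apply pos_INR].
Qed.

Lemma cont_shift f c : cont f -> cont (fun t => f (t + c)).
Proof.
intros Hc; apply (cont_comp f (fun t => t + c)); [exact Hc|].
apply cont_plus; [intros t; apply continuous_id|apply cont_const].
Qed.

Lemma Per_cont f : expdec f -> cont (Per f).
Proof.
intros H; apply cont_plus; apply Series_cont; try (now apply locdom_up); try (now apply locdom_dn);
  intros n; apply cont_shift, H.
Qed.

Lemma is_derive_shift (f : R -> R) (l c t : R) :
  is_derive f (t + c) l -> is_derive (fun t => f (t + c)) t l.
Proof.
intros H; evar_last.
- apply (is_derive_comp f (fun t => t + c) t l 1); [exact H|].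
  auto_derive; [exact I|ring].
- unfold scal; simpl; unfold mult; simpl; ring.
Qed.

Lemma Per_derive (f g : R -> R) : expdec f -> expdec g -> (forall t, is_derive f t (g t)) ->
  forall t, is_derive (Per f) t (Per g t).
Proof.
intros Hf Hg Hd t; apply @is_derive_plus.
- apply (Series_is_derive (fun n t => f (t + INR n)) (fun n t => g (t + INR n)));
  [now apply locdom_up|now apply locdom_up|intros n; apply cont_shift, Hg|].
  intros n x; now apply is_derive_shift.
- apply (Series_is_derive (fun n t => f (t - INR (S n))) (fun n t => g (t - INR (S n))));
  [now apply locdom_dn|now apply locdom_dn|intros n; apply cont_shift, Hg|].
  intros n x; now apply is_derive_shift.
Qed.

(** Moving t by 1 only transfers [f t] from the upward series to the head of the downward one. *)
Lemma Per_periodic f : expdec f -> periodic (Per f).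
Proof.
intros H t; unfold Per.
rewrite (Series_incr_1 (fun n => f (t + INR n))) by (apply (locdom_ex _ t (locdom_up f H))).
rewrite (Series_incr_1 (fun n => f (t + 1 - INR (S n))))
  by (apply (locdom_ex _ (t + 1) (locdom_dn f H))).
rewrite (Series_ext (fun n => f (t + 1 + INR n)) (fun n => f (t + INR (S n)))).
2: { intros n; rewrite S_INR; f_equal; ring. }
rewrite (Series_ext (fun n => f (t + 1 - INR (S (S n)))) (fun n => f (t - INR (S n)))).
2: { intros n; rewrite (S_INR (S n)); f_equal; ring. }
simpl INR; replace (t + 1 - 1) with t by ring; rewrite Rplus_0_r; ring.
Qed.

Lemma Per_plus f g t : expdec f -> expdec g -> Per (fun t => f t + g t) t = Per f t + Per g t.
Proof.
intros Hf Hg; unfold Per.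
rewrite (Series_plus (fun n => f (t + INR n))); [|apply (locdom_ex _ t (locdom_up f Hf))|apply (locdom_ex _ t (locdom_up g Hg))].
rewrite (Series_plus (fun n => f (t - INR (S n)))); [|apply (locdom_ex _ t (locdom_dn f Hf))|apply (locdom_ex _ t (locdom_dn g Hg))].
ring.
Qed.

Lemma Per_scal c f t : Per (fun t => c * f t) t = c * Per f t.
Proof. unfold Per; rewrite !Series_scal_l; ring. Qed.

Lemma Per_ext f g t : (forall t, f t = g t) -> Per f t = Per g t.
Proof. intros E; unfold Per; f_equal; apply Series_ext; intros; apply E. Qed.

Lemma periodic_up p : periodic p -> forall n t, p (t + INR n) = p t.
Proof.
intros H n; induction n as [|n IH]; intros t; [simpl; f_equal; ring|].
rewrite S_INR, <- (IH t), <- (H (t + INR n)); f_equal; ring.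
Qed.

Lemma periodic_dn p : periodic p -> forall n t, p (t - INR n) = p t.
Proof. intros H n t; rewrite <- (periodic_up p H n (t - INR n)); f_equal; ring. Qed.

(** A periodic factor is common to all translates; this is what unfolds the Fourier coefficients of
    a periodization. *)
Lemma Per_mult_periodic f p t : periodic p -> Per (fun t => f t * p t) t = Per f t * p t.
Proof.
intros Hp; unfold Per; rewrite Rmult_plus_distr_r; f_equal;
 rewrite <- Series_scal_r; apply Series_ext; intros n.
- now rewrite (periodic_up p Hp).
- now rewrite (periodic_dn p Hp).
Qed.

Lemma Per_abs_le f g c t : expdec g -> (forall t, Rabs (f t) <= c * g t) ->
  Rabs (Per f t) <= c * Per g t.
Proof.
intros Hg H; unfold Per; rewrite Rmult_plus_distr_l, <- !Series_scal_l.
eapply Rle_trans; [apply Rabs_triang|]; apply Rplus_le_compat; apply Series_abs_le.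
- intros n; apply H.
- apply (ex_series_scal (V := R_NormedModule)), (locdom_ex _ t (locdom_up g Hg)).
- intros n; apply H.
- apply (ex_series_scal (V := R_NormedModule)), (locdom_ex _ t (locdom_dn g Hg)).
Qed.

Lemma periodic_reduce t : exists n : nat, exists r, 0 <= r <= 1 /\ (t = r + INR n \/ t = r - INR n).
Proof.
destruct (archimed t) as [H1 H2].
set (z := (up t - 1)%Z).
assert (Hz : IZR z = IZR (up t) - 1) by (unfold z; now rewrite minus_IZR).
destruct (Z_le_gt_dec 0 z) as [H|H].
- exists (Z.to_nat z), (t - IZR z); split; [lra|left].
  rewrite INR_IZR_INZ, Z2Nat.id by exact H; ring.
- exists (Z.to_nat (- z)), (t - IZR z); split; [lra|right].
  rewrite INR_IZR_INZ, Z2Nat.id, opp_IZR by lia; ring.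
Qed.

Lemma cont_bounded f a b : a <= b -> cont f -> exists M, forall t, a <= t <= b -> Rabs (f t) <= M.
Proof.
intros Hab Hc.
destruct (continuity_ab_maj (fun t => Rabs (f t)) a b Hab) as [x [Hx _]].
- intros c _; apply continuity_pt_filterlim.
  apply (cont_comp Rabs f); [|exact Hc]. intros y; apply (continuous_abs y).
- exists (Rabs (f x)); exact Hx.
Qed.

Lemma periodic_bounded f : periodic f -> cont f -> exists M, forall t, Rabs (f t) <= M.
Proof.
intros Hp Hc; destruct (cont_bounded f 0 1 Rle_0_1 Hc) as [M HM].
exists M; intros t; destruct (periodic_reduce t) as [n [r [Hr [-> | ->]]]].
- rewrite periodic_up by exact Hp; now apply HM.
- rewrite periodic_dn by exact Hp; now apply HM.
Qed.

Lemma RInt_from_derive f a t : cont f -> is_derive (fun x => RInt f a x) t (f t).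
Proof.
intros Hc; apply (is_derive_RInt f _ a); [|apply Hc].
exists (mkposreal 1 Rlt_0_1); intros y _.
apply (RInt_correct (V := R_CompleteNormedModule)); now apply cont_ex_RInt.
Qed.

Lemma zero_derive_const (f : R -> R) a b : (forall t, is_derive f t 0) -> f a = f b.
Proof.
intros H; destruct (MVT_gen f a b (fun _ => 0)) as [c [_ E]].
- intros; apply H.
- intros x _; apply continuity_pt_filterlim, (ex_derive_continuous f x); exists 0; apply H.
- lra.
Qed.

(** As a function of [a] the integral has derivative f (a + 1) - f a = 0. *)
Lemma RInt_periodic f a : periodic f -> cont f -> RInt f a (a + 1) = RInt f 0 1.
Proof.
intros Hp Hc.
assert (E := zero_derive_const (fun x => RInt f 0 (x + 1) - RInt f 0 x) a 0).
cbv beta in E.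
rewrite <- (RInt_split f 0 a (a + 1) Hc), Rplus_0_l, RInt_point in E.
unfold zero in E; simpl in E.
assert (E' : forall t, is_derive (fun x => RInt f 0 (x + 1) - RInt f 0 x) t 0).
{ intros t; evar_last.
  - apply @is_derive_minus; [|apply RInt_from_derive, Hc].
    apply (is_derive_shift (fun x => RInt f 0 x)), RInt_from_derive, Hc.
  - rewrite Hp; unfold minus, plus, opp; simpl; ring. }
specialize (E E'); lra.
Qed.

(** Stands for the integral over the whole line. In this form linearity, translation and termwise
    integration reduce to a compact interval; [RIntR_lim] identifies it with the improper
    integral. *)
Definition RIntR (f : R -> R) : R := RInt (Per f) 0 1.

Lemma RIntR_plus f g : expdec f -> expdec g -> RIntR (fun t => f t + g t) = RIntR f + RIntR g.
Proof.
intros Hf Hg; unfold RIntR; rewrite <- RInt_Rplus by (now apply Per_cont).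
apply RInt_ext; intros; now apply Per_plus.
Qed.

Lemma RIntR_scal c f : expdec f -> RIntR (fun t => c * f t) = c * RIntR f.
Proof.
intros Hf; unfold RIntR; rewrite <- RInt_Rscal by (now apply Per_cont).
apply RInt_ext; intros; now apply Per_scal.
Qed.

Lemma RIntR_ext f g : (forall t, f t = g t) -> RIntR f = RIntR g.
Proof. intros E; unfold RIntR; apply RInt_ext; intros; now apply Per_ext. Qed.

(** Translating f translates its periodization, and a periodic function has the same integral over
    every period. *)
Lemma RIntR_shift f c : expdec f -> RIntR (fun t => f (t + c)) = RIntR f.
Proof.
intros Hf; unfold RIntR.
transitivity (RInt (fun t => Per f (t + c)) 0 1).
- apply RInt_ext; intros t _; unfold Per; f_equal; apply Series_ext; intros n; f_equal; ring.
- rewrite RInt_shift by (now apply Per_cont).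
  rewrite Rplus_0_l, (Rplus_comm 1).
  apply RInt_periodic; [now apply Per_periodic|now apply Per_cont].
Qed.

Lemma RIntR_abs_le f g c : expdec f -> expdec g -> (forall t, Rabs (f t) <= c * g t) ->
  Rabs (RIntR f) <= c * RIntR g.
Proof.
intros Hf Hg H; unfold RIntR; rewrite <- RInt_Rscal by (now apply Per_cont).
eapply Rle_trans; [apply abs_RInt_le; [lra|now apply cont_ex_RInt, Per_cont]|].
apply RInt_le; [lra| | |].
- apply cont_ex_RInt, (cont_comp Rabs (Per f)); [|now apply Per_cont].
  intros y; apply (continuous_abs y).
- now apply cont_ex_RInt, cont_scal, Per_cont.
- intros t _; now apply Per_abs_le.
Qed.

Lemma expdec_psum (f : nat -> R -> R) N : (forall n, expdec (f n)) ->
  expdec (fun t => psum (fun n => f n t) N).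
Proof.
intros H; induction N as [|N IH].
- apply expdec_ext with (f 0%nat); [intros; now rewrite psum_O|apply H].
- apply expdec_ext with (fun t => psum (fun n => f n t) N + f (S N) t).
  + intros; now rewrite psum_Sn.
  + now apply expdec_plus.
Qed.

Lemma RIntR_psum (f : nat -> R -> R) N : (forall n, expdec (f n)) ->
  RIntR (fun t => psum (fun n => f n t) N) = psum (fun n => RIntR (f n)) N.
Proof.
intros H; induction N as [|N IH].
- rewrite psum_O; apply RIntR_ext; intros; now rewrite psum_O.
- rewrite psum_Sn, <- IH, <- RIntR_plus; [|now apply expdec_psum|apply H].
  apply RIntR_ext; intros; now rewrite psum_Sn.
Qed.

(** The majorant separates the variables, so the error after n terms is at most the tail of [a]
    times the integral of [D]. *)
Lemma RIntR_Series (f : nat -> R -> R) (a : nat -> R) D :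
  (forall n, expdec (f n)) -> expdec D -> ex_series a -> (forall t, 0 <= D t) ->
  expdec (fun t => Series (fun n => f n t)) ->
  (forall n t, Rabs (f n t) <= a n * D t) ->
  is_series (fun n => RIntR (f n)) (RIntR (fun t => Series (fun n => f n t))).
Proof.
intros Hf HD Ha HD0 Hs Hb; apply is_series_eps; intros eps He.
destruct (Series_tail_small a Ha (eps / (Rabs (RIntR D) + 1))) as [N HN].
{ apply Rdiv_lt_0_compat; [exact He|]; generalize (Rabs_pos (RIntR D)); lra. }
exists N; intros n Hn; specialize (HN n Hn).
set (e := eps / (Rabs (RIntR D) + 1)) in *.
assert (He' : eps = e * (Rabs (RIntR D) + 1))
  by (unfold e; field; generalize (Rabs_pos (RIntR D)); lra).
assert (He0 : 0 < e) by (eapply Rle_lt_trans; [apply Rabs_pos|exact HN]).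
rewrite <- RIntR_psum by exact Hf.
rewrite Rabs_minus_sym; unfold Rminus.
rewrite <- (Rmult_1_l (RIntR (fun t => psum _ n))), Ropp_mult_distr_l.
rewrite <- RIntR_scal, <- RIntR_plus; [|exact Hs|now apply expdec_scal, expdec_psum|now apply expdec_psum].
apply Rle_lt_trans with (e * RIntR D).
- apply RIntR_abs_le; [apply expdec_plus; [exact Hs|now apply expdec_scal, expdec_psum]|exact HD|].
  intros t.
  replace (Series (fun k => f k t) + - (1) * psum (fun k => f k t) n) with
    (Series (fun k => f k t) - psum (fun k => f k t) n) by ring.
  eapply Rle_trans.
  + apply (Series_tail_le _ (fun k => a k * D t)); [intros k; apply Hb|].
    now apply ex_series_scal_r.
  + rewrite Series_scal_r.
    replace (psum (fun k => a k * D t) n) with (psum a n * D t).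
    * apply Rabs_def2 in HN; specialize (HD0 t); nra.
    * rewrite !psum_Reals; rewrite Rmult_comm, scal_sum; apply sum_eq; intros; ring.
- assert (H := Rle_abs (RIntR D)); rewrite He'; nra.
Qed.

(** Both signs of [k] are wanted: k < 0 controls tails at plus infinity, k > 0 those at minus
    infinity. *)
Lemma RInt_exp_bound f C k a b : k <> 0 -> a <= b -> cont f ->
  (forall t, Rabs (f t) <= C * exp (k * t)) ->
  Rabs (RInt f a b) <= C / k * (exp (k * b) - exp (k * a)).
Proof.
intros Hk Hab Hc Hb.
assert (Ce : cont (fun t => C * exp (k * t))).
{ apply (cont_derive _ (fun t => C * (k * exp (k * t)))); intros t; auto_derive; [exact I|ring]. }
eapply Rle_trans; [apply abs_RInt_le; [exact Hab|now apply cont_ex_RInt]|].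
eapply Rle_trans; [apply (RInt_le _ (fun t => C * exp (k * t))); [exact Hab| | |intros; apply Hb]|].
- apply cont_ex_RInt, (cont_comp Rabs f); [|exact Hc]. intros y; apply (continuous_abs y).
- now apply cont_ex_RInt.
- right; apply is_RInt_unique.
  evar_last.
  + apply (is_RInt_derive (V := R_CompleteNormedModule) (fun t => C / k * exp (k * t))).
    * intros x _; auto_derive; [exact I|field; exact Hk].
    * intros x _; apply Ce.
  + unfold minus, plus, opp; simpl; ring.
Qed.

(** Unit cells tile the line, so the partial sums of the two series are integrals over [0, N + 1]
    and [-(N + 1), 0]; what separates them from [a] and [b] are exponentially small tails. *)
Lemma RIntR_lim f : expdec f -> forall eps, 0 < eps ->
  exists M, forall a b, a <= - M -> M <= b -> Rabs (RInt f a b - RIntR f) < eps.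
Proof.
intros Hf eps Heps.
assert (Hf' := Hf); destruct Hf' as [Hc [C [e [HC [He Hb]]]]].
assert (Hu := RInt_Series _ 0 1 (locdom_up f Hf) (fun n => cont_shift f (INR n) Hc)).
assert (Hd := RInt_Series _ 0 1 (locdom_dn f Hf) (fun n => cont_shift f (- INR (S n)) Hc)).
set (U := RInt _ 0 1) in Hu; set (D := RInt _ 0 1) in Hd.
assert (E : RIntR f = U + D).
{ unfold RIntR, Per, U, D; apply RInt_Rplus; apply Series_cont;
  [now apply locdom_up|intros n; now apply cont_shift|now apply locdom_dn|intros n; now apply cont_shift]. }
assert (Pu : forall n, psum (fun n => RInt (fun t => f (t + INR n)) 0 1) n = RInt f 0 (INR (S n))).
{ induction n as [|n IH].
  - rewrite psum_O, RInt_shift by exact Hc; simpl; f_equal; ring.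
  - rewrite psum_Sn, IH, RInt_shift by exact Hc.
    rewrite Rplus_0_l, (Rplus_comm 1), <- S_INR; now apply RInt_split. }
assert (Pd : forall n, psum (fun n => RInt (fun t => f (t - INR (S n))) 0 1) n = RInt f (- INR (S n)) 0).
{ assert (Q : forall n, RInt (fun t => f (t - INR (S n))) 0 1 = RInt f (- INR (S n)) (- INR n)).
  { intros n; unfold Rminus; rewrite (RInt_shift f (- INR (S n))) by exact Hc.
    f_equal; rewrite S_INR; ring. }
  induction n as [|n IH].
  - rewrite psum_O, Q; simpl; f_equal; ring.
  - rewrite psum_Sn, IH, Q, Rplus_comm; now apply RInt_split. }
(* Four errors of [eps / 4]: two partial sums and two tails. *)
destruct (exp_small (C / e) e (eps / 4)) as [M [HM0 HM]]; [apply Rdiv_le_0_compat; lra|exact He|lra|].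
assert (HP : 0 <= C / e) by (apply Rdiv_le_0_compat; lra).
exists M; intros a b Ha Hb'.
destruct (proj1 (is_series_eps _ _) Hu (eps / 4)) as [N1 HN1]; [lra|].
destruct (proj1 (is_series_eps _ _) Hd (eps / 4)) as [N2 HN2]; [lra|].
(* [N3] makes N + 1 exceed both -a and b, so that the tiled interval contains [a, b]. *)
destruct (nfloor_ex (Rabs a + Rabs b)) as [N3 HN3].
{ generalize (Rabs_pos a) (Rabs_pos b); lra. }
assert (Hab : Rabs a = - a) by (apply Rabs_left1; lra).
assert (Hbb : Rabs b = b) by (apply Rabs_pos_eq; lra).
set (N := (N1 + N2 + N3)%nat).
assert (HN : INR N3 <= INR N) by (apply le_INR; unfold N; lia).
specialize (HN1 N ltac:(unfold N; lia)); specialize (HN2 N ltac:(unfold N; lia)).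
rewrite Pu in HN1; rewrite Pd in HN2.
assert (B1 : Rabs (RInt f b (INR (S N))) < eps / 4).
{ eapply Rle_lt_trans; [apply (RInt_exp_bound f C (- e)); [lra|rewrite S_INR; lra|exact Hc|]|].
  - intros t; eapply Rle_trans; [apply Hb|]; apply Rmult_le_compat_l; [exact HC|].
    apply exp_le_compat; generalize (Rle_abs t); nra.
  - eapply Rle_lt_trans; [|exact HM].
    replace (C / - e * (exp (- e * INR (S N)) - exp (- e * b))) with
      (C / e * (exp (- e * b) - exp (- e * INR (S N)))) by (field; lra).
    apply Rmult_le_compat_l; [exact HP|].
    assert (exp (- e * b) <= exp (- e * M)) by (apply exp_le_compat; nra).
    generalize (exp_pos (- e * INR (S N))); lra. }
assert (B2 : Rabs (RInt f (- INR (S N)) a) < eps / 4).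
{ eapply Rle_lt_trans; [apply (RInt_exp_bound f C e); [lra|rewrite S_INR; lra|exact Hc|]|].
  - intros t; eapply Rle_trans; [apply Hb|]; apply Rmult_le_compat_l; [exact HC|].
    apply exp_le_compat; rewrite <- (Rabs_Ropp t); generalize (Rle_abs (- t)); nra.
  - eapply Rle_lt_trans; [|exact HM].
    apply Rmult_le_compat_l; [exact HP|].
    assert (exp (e * a) <= exp (- e * M)) by (apply exp_le_compat; nra).
    generalize (exp_pos (e * - INR (S N))); lra. }
assert (S1 := RInt_split f 0 b (INR (S N)) Hc).
assert (S2 := RInt_split f (- INR (S N)) a 0 Hc).
assert (S3 := RInt_split f a 0 b Hc).
rewrite E; apply Rabs_def2 in HN1, HN2, B1, B2.
apply Rabs_def1; lra.
Qed.

(** * Pointwise convergence of Fourier series *)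

Ltac as_real := match goal with |- ?x = ?y => change (@eq R x y) end.
Ltac rring := try as_real; ring.
Ltac rfield := try as_real; field.

Lemma cont_sin_lin k c : cont (fun v => sin (k * v + c)).
Proof. apply (cont_derive _ (fun v => k * cos (k * v + c))); intros t; auto_derive; [exact I|ring]. Qed.

Lemma cont_cos_lin k c : cont (fun v => cos (k * v + c)).
Proof. apply (cont_derive _ (fun v => - (k * sin (k * v + c)))); intros t; auto_derive; [exact I|ring]. Qed.

Lemma Rabs_sin_le x : Rabs (sin x) <= 1.
Proof. apply Rabs_le, SIN_bound. Qed.

Lemma Rabs_cos_le x : Rabs (cos x) <= 1.
Proof. apply Rabs_le, COS_bound. Qed.

(* Shifting by half a period of the oscillation changes its sign, so twice the
   integral is governed by the modulus of continuity of [g]. *)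
Lemma riemann_lebesgue g a b : a <= b -> cont g -> forall eps, 0 < eps ->
  exists L, 0 < L /\ forall k c, L <= k -> Rabs (RInt (fun v => g v * sin (k * v + c)) a b) < eps.
Proof.
intros Hab Hg eps Heps.
destruct (cont_bounded g a (b + 1) ltac:(lra) Hg) as [M HM].
assert (HM0 : 0 <= M) by (eapply Rle_trans; [apply Rabs_pos|apply (HM a); lra]).
assert (He : 0 < eps / (b - a + 1)) by (apply Rdiv_lt_0_compat; lra).
destruct (unifcont_1d g a (b + 1) (fun x _ => Hg x) (mkposreal _ He)) as [d Hd].
assert (Hd0 := cond_pos d).
(* The three bounds serve uniform continuity, keeping the shifted interval inside [a, b + 1], and
   the two end pieces left over by the shift, each at most [h * M]. *)
set (m := Rmin (Rmin d 1) (eps / (2 * (M + 1)))).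
assert (Hm0 : 0 < m).
{ unfold m; repeat apply Rmin_glb_lt; try lra. apply Rdiv_lt_0_compat; lra. }
assert (Hm1 : m <= d) by (unfold m; eapply Rle_trans; [apply Rmin_l|apply Rmin_l]).
assert (Hm2 : m <= 1) by (unfold m; eapply Rle_trans; [apply Rmin_l|apply Rmin_r]).
assert (Hm3 : m * (2 * (M + 1)) <= eps).
{ apply Rle_trans with (eps / (2 * (M + 1)) * (2 * (M + 1))).
  - apply Rmult_le_compat_r; [lra|apply Rmin_r].
  - right; field; lra. }
assert (HPI := PI_RGT_0).
exists (2 * PI / m); split; [apply Rdiv_lt_0_compat; lra|].
intros k c Hk.
assert (Hk0 : 0 < k).
{ eapply Rlt_le_trans; [|exact Hk]; apply Rdiv_lt_0_compat; lra. }
set (h := PI / k).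
assert (Hh0 : 0 < h) by (apply Rdiv_lt_0_compat; lra).
assert (Hh : 2 * h <= m).
{ unfold h; apply Rmult_le_reg_r with k; [exact Hk0|].
  replace (2 * (PI / k) * k) with (2 * PI / m * m) by (field; lra).
  rewrite (Rmult_comm m); apply Rmult_le_compat_r; lra. }
set (G := fun v => g v * sin (k * v + c)).
assert (HG : cont G) by (apply cont_mult; [exact Hg|apply cont_sin_lin]).
assert (Cs : cont (fun v => g (v + h) * sin (k * v + c)))
  by (apply cont_mult; [now apply cont_shift|apply cont_sin_lin]).
assert (E1 : RInt (fun v => G (v + h)) a b = - RInt (fun v => g (v + h) * sin (k * v + c)) a b).
{ replace (- RInt (fun v => g (v + h) * sin (k * v + c)) a b) with
    (-1 * RInt (fun v => g (v + h) * sin (k * v + c)) a b) by ring.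
  rewrite <- RInt_Rscal by exact Cs.
  apply RInt_ext; intros v _; unfold G.
  replace (k * (v + h) + c) with ((k * v + c) + PI) by (unfold h; field; lra).
  rewrite neg_sin; as_real; ring. }
rewrite RInt_shift in E1 by exact HG.
assert (E2 : RInt (fun v => (g v - g (v + h)) * sin (k * v + c)) a b =
             RInt G a b - RInt (fun v => g (v + h) * sin (k * v + c)) a b).
{ rewrite <- RInt_Rminus by assumption. apply RInt_ext; intros; unfold G; as_real; ring. }
assert (S1 := RInt_split G a (a + h) (b + h) HG).
assert (S2 := RInt_split G a b (b + h) HG).
assert (BG : forall t, a <= t <= b + 1 -> Rabs (G t) <= M).
{ intros t Ht; unfold G; rewrite Rabs_mult.
  rewrite <- (Rmult_1_r M); apply Rmult_le_compat; auto using Rabs_pos, Rabs_sin_le. }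
assert (B1 : Rabs (RInt G a (a + h)) <= h * M).
{ replace h with (Rabs (a + h - a)) at 2 by (rewrite Rabs_pos_eq; lra).
  apply RInt_abs_bound; [exact HG|]; intros t; rewrite Rmin_left, Rmax_right by lra.
  intros Ht; apply BG; lra. }
assert (B2 : Rabs (RInt G b (b + h)) <= h * M).
{ replace h with (Rabs (b + h - b)) at 2 by (rewrite Rabs_pos_eq; lra).
  apply RInt_abs_bound; [exact HG|]; intros t; rewrite Rmin_left, Rmax_right by lra.
  intros Ht; apply BG; lra. }
set (e := eps / (b - a + 1)) in *.
assert (Ee : e * (b - a + 1) = eps) by (unfold e; field; lra).
assert (B3 : Rabs (RInt (fun v => (g v - g (v + h)) * sin (k * v + c)) a b) <= (b - a) * e).
{ rewrite <- (Rabs_pos_eq (b - a)) by lra. apply RInt_abs_bound.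
  - apply cont_mult; [|apply cont_sin_lin].
    intros t; apply (continuous_minus g (fun v => g (v + h)));
    [apply Hg|now apply cont_shift].
  - intros t; rewrite Rmin_left, Rmax_right by lra; intros Ht.
    rewrite Rabs_mult, <- (Rmult_1_r e).
    apply Rmult_le_compat; auto using Rabs_pos, Rabs_sin_le.
    destruct (Rle_lt_dec (Rabs (g t - g (t + h))) e) as [Q|Q]; [exact Q|exfalso].
    apply (Hd t (t + h)); [lra|lra| |].
    + change (Rabs (t + h - t) < d); rewrite Rabs_pos_eq; lra.
    + intros Q2; change (Rabs (g (t + h) - g t) < e) in Q2.
      rewrite Rabs_minus_sym in Q2; lra. }
fold G; apply Rabs_le_between in B1, B2, B3.
assert (h * M < eps / 2) by nra.
apply Rabs_def1; nra.
Qed.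

(** Completing the quotient at 0 by the derivative makes it continuous, which is all the regularity
    that Chernoff's argument asks of it. *)
Definition diffquot (f : R -> R) (l t v : R) : R :=
  if Req_EM_T v 0 then l else (f (t + v) - f t) / v.

Lemma diffquot_mult f l t v : v * diffquot f l t v = f (t + v) - f t.
Proof.
unfold diffquot; destruct (Req_EM_T v 0) as [->|H]; [rewrite Rplus_0_r; ring|field; exact H].
Qed.

Lemma diffquot_cont f l t : cont f -> is_derive f t l -> cont (diffquot f l t).
Proof.
intros Hc Hd v; destruct (Req_EM_T v 0) as [->|Hv].
- apply continuous_eps; intros eps He.
  destruct (proj1 (is_derive_Reals f t l) Hd eps He) as [d H].
  exists d; split; [apply cond_pos|]; intros y Hy.
  unfold diffquot; destruct (Req_EM_T 0 0) as [_|]; [|easy].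
  destruct (Req_EM_T y 0) as [->|Hy0]; [rewrite Rminus_diag, Rabs_R0; exact He|].
  apply H; [exact Hy0|]; now rewrite Rminus_0_r in Hy.
- apply continuous_ext_loc with (fun v => (f (v + t) - f t) * / v).
  + exists (mkposreal _ (Rabs_pos_lt v Hv)); intros y Hy.
    unfold diffquot; destruct (Req_EM_T y 0) as [->|Hy0]; [|now rewrite (Rplus_comm y)].
    exfalso; change (Rabs (0 - v) < Rabs v) in Hy.
    rewrite Rminus_0_l, Rabs_Ropp in Hy; lra.
  + apply (continuous_mult (fun v => f (v + t) - f t) (fun v => / v)).
    * apply (cont_plus (fun v => f (v + t)) (fun _ => - f t)); [now apply cont_shift|apply cont_const].
    * now apply (continuous_Rinv v).
Qed.

(** Dirichlet kernel: 2 sin(PI v) cos(2 PI k v) is the sine of (2k + 1) PI v minus the sine of (2k -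
    1) PI v, so the sum telescopes. *)
Lemma dirichlet_cos v n :
  2 * sin (PI * v) * psum (fun k => cos (2 * PI * INR (S k) * v)) n =
  sin ((2 * INR n + 3) * PI * v) - sin (PI * v).
Proof.
induction n as [|n IH].
- rewrite psum_O; simpl INR.
  replace ((2 * 0 + 3) * PI * v) with (2 * PI * 1 * v + PI * v) by ring.
  replace (sin (PI * v)) with (sin (2 * PI * 1 * v - PI * v)) at 2 by (f_equal; ring).
  rewrite sin_plus, sin_minus; ring.
- rewrite psum_Sn, Rmult_plus_distr_l, IH, !S_INR.
  replace ((2 * (INR n + 1) + 3) * PI * v) with (2 * PI * (INR n + 1 + 1) * v + PI * v) by ring.
  replace ((2 * INR n + 3) * PI * v) with (2 * PI * (INR n + 1 + 1) * v - PI * v) by ring.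
  rewrite sin_plus, sin_minus; ring.
Qed.

(** The conjugate kernel, telescoping in cosines; through it each half of the bilateral Fourier sum
    converges separately. *)
Lemma dirichlet_sin v n :
  2 * sin (PI * v) * psum (fun k => sin (2 * PI * INR (S k) * v)) n =
  cos (PI * v) - cos ((2 * INR n + 3) * PI * v).
Proof.
induction n as [|n IH].
- rewrite psum_O; simpl INR.
  replace ((2 * 0 + 3) * PI * v) with (2 * PI * 1 * v + PI * v) by ring.
  replace (cos (PI * v)) with (cos (2 * PI * 1 * v - PI * v)) by (f_equal; ring).
  rewrite cos_plus, cos_minus; ring.
- rewrite psum_Sn, Rmult_plus_distr_l, IH, !S_INR.
  replace ((2 * (INR n + 1) + 3) * PI * v) with (2 * PI * (INR n + 1 + 1) * v + PI * v) by ring.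
  replace ((2 * INR n + 3) * PI * v) with (2 * PI * (INR n + 1 + 1) * v - PI * v) by ring.
  rewrite cos_plus, cos_minus; ring.
Qed.

Lemma sin_PI_INR n : sin (PI * INR n) = 0.
Proof. rewrite Rmult_comm, INR_IZR_INZ; apply sin_eq_0_1; now exists (Z.of_nat n). Qed.

Lemma RInt_cos_period k : RInt (fun v => cos (2 * PI * INR (S k) * v)) (- (1 / 2)) (1 / 2) = 0.
Proof.
assert (HPI := PI_RGT_0); assert (Hk : 0 < INR (S k)) by (apply lt_0_INR; lia).
assert (Hs := sin_PI_INR (S k)); generalize dependent (INR (S k)); intros m Hm Hs.
apply is_RInt_unique; evar_last.
- apply (is_RInt_derive (V := R_CompleteNormedModule) (fun v => sin (2 * PI * m * v) / (2 * PI * m))).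
  + intros x _; auto_derive; [exact I|field; split; lra].
  + intros x _; apply continuous_ext with (fun v => cos (2 * PI * m * v + 0));
    [intros; now rewrite Rplus_0_r|apply cont_cos_lin].
- unfold minus, plus, opp; simpl; as_real.
  replace (2 * PI * m * (1 / 2)) with (PI * m) by field.
  replace (2 * PI * m * (- (1 / 2))) with (- (PI * m)) by field.
  rewrite sin_neg, Hs; unfold Rdiv; as_real; ring.
Qed.

Lemma RInt_sin_period k : RInt (fun v => sin (2 * PI * INR (S k) * v)) (- (1 / 2)) (1 / 2) = 0.
Proof.
assert (HPI := PI_RGT_0); assert (Hk : 0 < INR (S k)) by (apply lt_0_INR; lia).
generalize dependent (INR (S k)); intros m Hm.
apply is_RInt_unique; evar_last.
- apply (is_RInt_derive (V := R_CompleteNormedModule) (fun v => - cos (2 * PI * m * v) / (2 * PI * m))).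
  + intros x _; auto_derive; [exact I|field; split; lra].
  + intros x _; apply continuous_ext with (fun v => sin (2 * PI * m * v + 0));
    [intros; now rewrite Rplus_0_r|apply cont_sin_lin].
- unfold minus, plus, opp; simpl; as_real.
  replace (2 * PI * m * (1 / 2)) with (PI * m) by field.
  replace (2 * PI * m * (- (1 / 2))) with (- (PI * m)) by field.
  rewrite cos_neg; unfold Rdiv; as_real; ring.
Qed.

Lemma periodic_cos k t : periodic (fun u => cos (2 * PI * INR k * (u - t))).
Proof.
intros u.
replace (2 * PI * INR k * (u + 1 - t)) with (2 * PI * INR k * (u - t) + 2 * INR k * PI) by ring.
apply cos_period.
Qed.

Lemma periodic_sin k t : periodic (fun u => sin (2 * PI * INR k * (u - t))).
Proof.
intros u.
replace (2 * PI * INR k * (u + 1 - t)) with (2 * PI * INR k * (u - t) + 2 * INR k * PI) by ring.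
apply sin_period.
Qed.

Lemma cont_cos_fourier k t : cont (fun u => cos (2 * PI * INR k * (u - t))).
Proof.
intros u; apply continuous_ext with (fun v => cos (2 * PI * INR k * v + - (2 * PI * INR k * t)));
 [intros; f_equal; ring|apply cont_cos_lin].
Qed.

Lemma cont_sin_fourier k t : cont (fun u => sin (2 * PI * INR k * (u - t))).
Proof.
intros u; apply continuous_ext with (fun v => sin (2 * PI * INR k * v + - (2 * PI * INR k * t)));
 [intros; f_equal; ring|apply cont_sin_lin].
Qed.

(** On the centred period sin(PI v) vanishes only at v = 0, where the difference quotient
    compensates. *)
Lemma RInt_periodic_center f t : periodic f -> cont f ->
  RInt f 0 1 = RInt (fun v => f (v + t)) (- (1 / 2)) (1 / 2).
Proof.
intros Hp Hc; rewrite RInt_shift by exact Hc.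
replace (1 / 2 + t) with (- (1 / 2) + t + 1) by field.
symmetry; now apply RInt_periodic.
Qed.

(* Chernoff's proof: dividing [f (t + v) - f t] by [2 sin (PI v)] turns the
   partial sums into integrals of [g] against a single oscillation. *)
Theorem fourier_pointwise (f f' : R -> R) (t : R) :
  periodic f -> (forall u, is_derive f u (f' u)) ->
  let X k := RInt (fun u => f u * cos (2 * PI * INR k * (u - t))) 0 1 in
  let Y k := RInt (fun u => f u * sin (2 * PI * INR k * (u - t))) 0 1 in
  exists x y, is_series X (f t - x) /\ is_series (fun k => X (S k)) x /\
              is_series (fun k => Y (S k)) y.
Proof.
intros Hp Hd X Y.
assert (Hc : cont f) by exact (cont_derive f f' Hd).
assert (HPI := PI_RGT_0).
set (F := fun v => f (t + v) - f t).
assert (HF : cont F).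
{ apply (cont_plus (fun v => f (t + v)) (fun _ => - f t)); [|apply cont_const].
  intros v; apply continuous_ext with (fun v => f (v + t)); [intros; f_equal; rring|now apply cont_shift]. }
(* A nonzero frequency annihilates the constant [f t], so f may be replaced by [F], which vanishes
   at 0. *)
assert (Ecos : forall k, X (S k) = RInt (fun v => F v * cos (2 * PI * INR (S k) * v)) (- (1 / 2)) (1 / 2)).
{ intros k; unfold X; rewrite (RInt_periodic_center _ t).
  - transitivity (RInt (fun v => F v * cos (2 * PI * INR (S k) * v) + f t * cos (2 * PI * INR (S k) * v + 0)) (- (1 / 2)) (1 / 2)).
    + apply RInt_ext; intros v _; unfold F.
      replace (v + t - t) with v by rring; rewrite (Rplus_comm v t), Rplus_0_r; rring.
    + rewrite RInt_Rplus.
      * rewrite RInt_Rscal by apply cont_cos_lin.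
        rewrite (RInt_ext (fun v => cos (2 * PI * INR (S k) * v + 0)) (fun v => cos (2 * PI * INR (S k) * v))),
          RInt_cos_period by (intros; now rewrite Rplus_0_r).
        rring.
      * apply cont_mult; [exact HF|].
        intros v; apply continuous_ext with (fun v => cos (2 * PI * INR (S k) * v + 0));
         [intros; now rewrite Rplus_0_r|apply cont_cos_lin].
      * apply cont_scal, cont_cos_lin.
  - intros u; now rewrite Hp, periodic_cos.
  - apply cont_mult; [exact Hc|apply cont_cos_fourier]. }
assert (Esin : forall k, Y (S k) = RInt (fun v => F v * sin (2 * PI * INR (S k) * v)) (- (1 / 2)) (1 / 2)).
{ intros k; unfold Y; rewrite (RInt_periodic_center _ t).
  - transitivity (RInt (fun v => F v * sin (2 * PI * INR (S k) * v) + f t * sin (2 * PI * INR (S k) * v + 0)) (- (1 / 2)) (1 / 2)).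
    + apply RInt_ext; intros v _; unfold F.
      replace (v + t - t) with v by rring; rewrite (Rplus_comm v t), Rplus_0_r; rring.
    + rewrite RInt_Rplus.
      * rewrite RInt_Rscal by apply cont_sin_lin.
        rewrite (RInt_ext (fun v => sin (2 * PI * INR (S k) * v + 0)) (fun v => sin (2 * PI * INR (S k) * v))),
          RInt_sin_period by (intros; now rewrite Rplus_0_r).
        rring.
      * apply cont_mult; [exact HF|].
        intros v; apply continuous_ext with (fun v => sin (2 * PI * INR (S k) * v + 0));
         [intros; now rewrite Rplus_0_r|apply cont_sin_lin].
      * apply cont_scal, cont_sin_lin.
  - intros u; now rewrite Hp, periodic_sin.
  - apply cont_mult; [exact Hc|apply cont_sin_fourier]. }
assert (E0 : X 0%nat = RInt F (- (1 / 2)) (1 / 2) + f t).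
{ unfold X; rewrite (RInt_periodic_center _ t).
  - transitivity (RInt (fun v => F v + f t) (- (1 / 2)) (1 / 2)).
    + apply RInt_ext; intros v _; unfold F; simpl INR.
      replace (2 * PI * 0 * (v + t - t)) with 0 by rring.
      rewrite cos_0, (Rplus_comm v t); rring.
    + rewrite RInt_Rplus, RInt_const by (trivial; apply cont_const).
      unfold scal; simpl; unfold mult; simpl; rfield.
  - intros u; rewrite Hp; f_equal; simpl INR; f_equal; rring.
  - apply cont_mult; [exact Hc|apply cont_cos_fourier]. }
(* F v / (2 sin(PI v)) becomes q1 / (2 q2) once numerator and denominator are divided by v, which
   removes the singularity at 0. *)
set (q1 := diffquot f (f' t) t).
set (q2 := diffquot (fun v => sin (PI * v)) PI 0).
assert (Hq1 : cont q1) by now apply diffquot_cont.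
assert (Hq2 : cont q2).
{ apply diffquot_cont.
  - intros v; apply continuous_ext with (fun v => sin (PI * v + 0));
      [intros; now rewrite Rplus_0_r|apply cont_sin_lin].
  - auto_derive; [exact I|]. rewrite Rmult_0_r, cos_0; rring. }
assert (Eq2 : forall v, v * q2 v = sin (PI * v)).
{ intros v; unfold q2; rewrite diffquot_mult, Rplus_0_l, Rmult_0_r, sin_0; rring. }
assert (Nq2 : forall v, - (1 / 2) <= v <= 1 / 2 -> q2 v <> 0).
{ intros v Hv Hz; destruct (Req_EM_T v 0) as [->|Hv0].
  - unfold q2, diffquot in Hz; destruct (Req_EM_T 0 0); [lra|easy].
  - assert (E := Eq2 v); rewrite Hz, Rmult_0_r in E.
    destruct (Rlt_le_dec 0 v) as [Q|Q].
    + assert (0 < sin (PI * v)) by (apply sin_gt_0; nra); lra.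
    + assert (0 < sin (PI * - v)) by (apply sin_gt_0; nra).
      rewrite <- Ropp_mult_distr_r, sin_neg in H; lra. }
(* [riemann_lebesgue] asks for continuity on the whole line, but [q2] may vanish off this interval,
   as at v = 1. *)
destruct (C0_extension_le (fun v => q1 v * / (2 * q2 v)) (- (1 / 2)) (1 / 2)) as [g [Hg Eg]].
{ intros c Hcc; apply (continuous_mult q1 (fun v => / (2 * q2 v))); [apply Hq1|].
  apply (continuous_comp (fun v => 2 * q2 v) Rinv); [now apply cont_scal|].
  apply continuous_Rinv; assert (N := Nq2 c Hcc); lra. }
assert (Hg' : cont g) by exact Hg.
assert (FG : forall v, - (1 / 2) <= v <= 1 / 2 -> F v = g v * (2 * sin (PI * v))).
{ intros v Hv; rewrite Eg by exact Hv; rewrite <- Eq2; unfold F.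
  rewrite <- (diffquot_mult f (f' t)); fold q1; rfield; now apply Nq2. }
assert (Rm : Rmin (- (1 / 2)) (1 / 2) = - (1 / 2)) by (apply Rmin_left; lra).
assert (Rx : Rmax (- (1 / 2)) (1 / 2) = 1 / 2) by (apply Rmax_right; lra).
assert (Cc : forall k, cont (fun v => cos (k * v))).
{ intros k v; apply continuous_ext with (fun v => cos (k * v + 0)); [intros; now rewrite Rplus_0_r|apply cont_cos_lin]. }
assert (Cs : forall k, cont (fun v => sin (k * v))).
{ intros k v; apply continuous_ext with (fun v => sin (k * v + 0)); [intros; now rewrite Rplus_0_r|apply cont_sin_lin]. }
(* The constant part sin(PI v) of the kernel, multiplied by [g], is F / 2; only the oscillating part
   depends on n. *)
assert (PX : forall n, psum (fun k => X (S k)) n =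
  RInt (fun v => g v * sin ((2 * INR n + 3) * PI * v + 0)) (- (1 / 2)) (1 / 2) - 1 / 2 * RInt F (- (1 / 2)) (1 / 2)).
{ intros n; rewrite <- RInt_Rscal by exact HF.
  rewrite <- RInt_Rminus; [|apply cont_mult; [exact Hg|apply cont_sin_lin]|now apply cont_scal].
  transitivity (psum (fun k => RInt (fun v => F v * cos (2 * PI * INR (S k) * v)) (- (1 / 2)) (1 / 2)) n).
  - rewrite !psum_Reals; apply sum_eq; intros i _; apply Ecos.
  - rewrite <- RInt_psum by (intros k; apply cont_mult; [exact HF|apply Cc]).
    apply RInt_ext; rewrite Rm, Rx; intros v Hv.
    replace (psum (fun k => F v * cos (2 * PI * INR (S k) * v)) n) with
      (F v * psum (fun k => cos (2 * PI * INR (S k) * v)) n).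
    + rewrite FG by lra; rewrite Rplus_0_r.
      transitivity (g v * (2 * sin (PI * v) * psum (fun k => cos (2 * PI * INR (S k) * v)) n)); [rring|].
      rewrite dirichlet_cos; rfield.
    + rewrite !psum_Reals, scal_sum; apply sum_eq; intros; rring. }
(* The oscillating cosine is written as a sine of phase [PI / 2], so the same Riemann-Lebesgue lemma
   applies. *)
assert (PY : forall n, psum (fun k => Y (S k)) n =
  RInt (fun v => g v * cos (PI * v)) (- (1 / 2)) (1 / 2) -
  RInt (fun v => g v * sin ((2 * INR n + 3) * PI * v + PI / 2)) (- (1 / 2)) (1 / 2)).
{ intros n; rewrite <- RInt_Rminus; [|apply cont_mult; [exact Hg|apply Cc]|apply cont_mult; [exact Hg|apply cont_sin_lin]].
  transitivity (psum (fun k => RInt (fun v => F v * sin (2 * PI * INR (S k) * v)) (- (1 / 2)) (1 / 2)) n).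
  - rewrite !psum_Reals; apply sum_eq; intros i _; apply Esin.
  - rewrite <- RInt_psum by (intros k; apply cont_mult; [exact HF|apply Cs]).
    apply RInt_ext; rewrite Rm, Rx; intros v Hv.
    replace (psum (fun k => F v * sin (2 * PI * INR (S k) * v)) n) with
      (F v * psum (fun k => sin (2 * PI * INR (S k) * v)) n).
    + rewrite FG by lra; rewrite (Rplus_comm _ (PI / 2)), <- cos_sin.
      transitivity (g v * (2 * sin (PI * v) * psum (fun k => sin (2 * PI * INR (S k) * v)) n)); [rring|].
      rewrite dirichlet_sin; rfield.
    + rewrite !psum_Reals, scal_sum; apply sum_eq; intros; rring. }
assert (RL : forall c eps, 0 < eps -> exists N, forall n, (N <= n)%nat ->
  Rabs (RInt (fun v => g v * sin ((2 * INR n + 3) * PI * v + c)) (- (1 / 2)) (1 / 2)) < eps).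
{ intros c eps He.
  destruct (riemann_lebesgue g (- (1 / 2)) (1 / 2) ltac:(lra) Hg' eps He) as [L [HL0 HL]].
  destruct (nfloor_ex (L / PI)) as [N HN]; [apply Rdiv_le_0_compat; lra|].
  exists N; intros n Hn; apply HL.
  assert (INR N <= INR n) by (now apply le_INR).
  assert (L = L / PI * PI) by (rfield; lra).
  assert (0 <= INR n) by apply pos_INR. nra. }
(* With x equal to minus half the integral of F, the value of [X 0] found in [E0] makes the half
   starting at 0 sum to f t - x; together the halves give [f t]. *)
exists (- (1 / 2 * RInt F (- (1 / 2)) (1 / 2))), (RInt (fun v => g v * cos (PI * v)) (- (1 / 2)) (1 / 2)).
assert (S1 : is_series (fun k => X (S k)) (- (1 / 2 * RInt F (- (1 / 2)) (1 / 2)))).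
{ apply is_series_eps; intros eps He; destruct (RL 0 eps He) as [N HN].
  exists N; intros n Hn; rewrite PX; specialize (HN n Hn).
  assert (Q : forall p q : R, p - q - - q = p) by (intros; ring).
  now rewrite Q. }
split; [|split; [exact S1|]].
- apply (is_series_decr_1 (V := R_NormedModule) X).
  match goal with |- is_series _ ?l => replace l with (- (1 / 2 * RInt F (- (1 / 2)) (1 / 2))); [exact S1|] end.
  rewrite E0; unfold plus, opp; simpl; rfield.
- apply is_series_eps; intros eps He; destruct (RL (PI / 2) eps He) as [N HN].
  exists N; intros n Hn; rewrite PY; specialize (HN n Hn).
  assert (Q : forall p q : R, p - q - p = - q) by (intros; ring).
  now rewrite Q, Rabs_Ropp.
Qed.

(** * Digits *)

(** The bound is exclusive, unlike in [psum], to suit ranges n < b^l cut into equal blocks. *)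
Fixpoint nsum (g : nat -> R) (M : nat) : R :=
  match M with O => 0 | S M' => nsum g M' + g M' end.

Lemma nsum_psum g n : nsum g (S n) = psum g n.
Proof.
induction n as [|n IH]; [rewrite psum_O; simpl; ring|].
rewrite psum_Sn, <- IH; reflexivity.
Qed.

Lemma nsum_ext g h M : (forall n, (n < M)%nat -> g n = h n) -> nsum g M = nsum h M.
Proof.
induction M as [|M IH]; intros H; simpl; [reflexivity|].
rewrite IH, H by (intros; try apply H; lia); reflexivity.
Qed.

Lemma nsum_le g h M : (forall n, (n < M)%nat -> g n <= h n) -> nsum g M <= nsum h M.
Proof.
induction M as [|M IH]; intros H; simpl; [lra|].
apply Rplus_le_compat; [apply IH; intros; apply H; lia|apply H; lia].
Qed.

Lemma nsum_nonneg g M : (forall n, 0 <= g n) -> 0 <= nsum g M.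
Proof. intros H; induction M as [|M IH]; simpl; [lra|specialize (H M); lra]. Qed.

Lemma nsum_plus g h M : nsum (fun n => g n + h n) M = nsum g M + nsum h M.
Proof. induction M as [|M IH]; simpl; [ring|rewrite IH; ring]. Qed.

Lemma nsum_scal c g M : nsum (fun n => c * g n) M = c * nsum g M.
Proof. induction M as [|M IH]; simpl; [ring|rewrite IH; ring]. Qed.

Lemma nsum_split g M K : nsum g (M + K) = nsum g M + nsum (fun k => g (M + k)%nat) K.
Proof.
induction K as [|K IH]; [rewrite Nat.add_0_r; simpl; ring|].
rewrite Nat.add_succ_r; simpl; rewrite IH; ring.
Qed.

Lemma nsum_mono g M K : (forall n, 0 <= g n) -> (M <= K)%nat -> nsum g M <= nsum g K.
Proof.
intros H HMK; replace K with (M + (K - M))%nat by lia; rewrite nsum_split.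
assert (0 <= nsum (fun k => g (M + k)%nat) (K - M)) by (apply nsum_nonneg; intros; apply H); lra.
Qed.

Lemma nsum_blocks g d m : nsum g (d * m) = nsum (fun i => nsum (fun n => g (i * m + n)%nat) m) d.
Proof.
induction d as [|d IH]; [reflexivity|].
replace (S d * m)%nat with (d * m + m)%nat by lia; rewrite nsum_split, IH; reflexivity.
Qed.

Lemma nsum_single M k c : (k < M)%nat -> nsum (fun d => if Nat.eq_dec d k then c else 0) M = c.
Proof.
assert (H0 : forall M, (M <= k)%nat -> nsum (fun d => if Nat.eq_dec d k then c else 0) M = 0).
{ induction M0 as [|M0 IH]; intros H; simpl; [reflexivity|].
  rewrite IH by lia; destruct (Nat.eq_dec M0 k); [lia|ring]. }
induction M as [|M IH]; intros H; [lia|]; simpl.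
destruct (Nat.eq_dec M k) as [E|E]; [rewrite H0 by lia; ring|rewrite IH by lia; ring].
Qed.

Definition lsum (l : list R) : R := fold_right Rplus 0 l.

Lemma lsum_app l l' : lsum (l ++ l') = lsum l + lsum l'.
Proof. induction l as [|x l IH]; simpl; [ring|unfold lsum in *; simpl; rewrite IH; ring]. Qed.

Lemma lsum_flat_map {T U : Type} (H : U -> R) (k : T -> list U) (l : list T) :
  lsum (map H (flat_map k l)) = lsum (map (fun a => lsum (map H (k a))) l).
Proof.
induction l as [|x l IH]; [reflexivity|].
simpl; rewrite map_app, lsum_app, IH; reflexivity.
Qed.

Lemma b_pos b : (2 <= b)%nat -> 0 < INR b.
Proof. intros Hb; apply lt_0_INR; lia. Qed.

Lemma ln_b_pos b : (2 <= b)%nat -> 0 < ln (INR b).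
Proof.
intros Hb; rewrite <- ln_1; apply ln_increasing; [lra|]; change 1 with (INR 1); apply lt_INR; lia.
Qed.

Lemma INR1_pos n : 0 < INR n + 1.
Proof. generalize (pos_INR n); lra. Qed.

Section Digits.

Variables (b : nat) (A : list nat).
Hypotheses (Hb : (2 <= b)%nat) (HAnd : NoDup A)
  (HAb : List.Forall (fun a => (a < b)%nat) A) (Hmax : fmax A = (b - 1)%nat).

(** Indicator of the complemented digit set, meaningful for d < b only: beyond, the subtraction
    truncates. *)
Definition digit (d : nat) : R := if in_dec Nat.eq_dec (b - 1 - d)%nat A then 1 else 0.

(** Reindexing by a = b - 1 - d. [NoDup] makes each new letter switch on exactly one digit. *)
Lemma lsum_digits (G : nat -> R) :
  lsum (map G A) = nsum (fun d => digit d * G (b - 1 - d)%nat) b.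
Proof.
unfold digit; clear Hmax; revert HAnd HAb; induction A as [|a A' IH]; intros Hnd Hlt.
- simpl; symmetry; rewrite (nsum_ext _ (fun _ => 0 * 0)), nsum_scal; [ring|].
  intros; simpl; ring.
- inversion Hnd as [|? ? Hni Hnd']; subst; inversion Hlt as [|? ? Ha Hlt']; subst.
  change (lsum (map G (a :: A'))) with (G a + lsum (map G A')).
  rewrite IH by assumption.
  rewrite <- (nsum_single b (b - 1 - a) (G a)) by lia.
  rewrite <- nsum_plus; apply nsum_ext; intros d Hd.
  destruct (Nat.eq_dec d (b - 1 - a)) as [->|E].
  + replace (b - 1 - (b - 1 - a))%nat with a by lia.
    destruct (in_dec Nat.eq_dec a (a :: A')) as [_|Q]; [|exfalso; apply Q; now left].
    destruct (in_dec Nat.eq_dec a A'); [easy|ring].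
  + destruct (in_dec Nat.eq_dec (b - 1 - d)%nat (a :: A')) as [[Q|Q]|Q];
    destruct (in_dec Nat.eq_dec (b - 1 - d)%nat A') as [Q'|Q']; try ring; try easy; try lia.
    exfalso; apply Q; now right.
Qed.

Lemma fmax_in : In (b - 1)%nat A.
Proof.
assert (H : forall l, l = [] \/ In (fmax l) l).
{ clear; induction l as [|x l [->|IH]]; [now left|right; left; unfold fmax; simpl; lia|right].
  change (fmax (x :: l)) with (Nat.max x (fmax l)).
  destruct (Nat.max_dec x (fmax l)) as [E|E]; rewrite E; [now left|now right]. }
rewrite <- Hmax; destruct (H A) as [E|E]; [|exact E].
rewrite E in Hmax; simpl in Hmax; lia.
Qed.

(** Since b - 1 is in [A], 0 is an admissible digit: leading zeros are harmless and the condition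
    may be imposed at every position. This is where max A = b - 1 enters. *)
Lemma inB_alt n : inB b A n <-> forall i, In (b - 1 - (n / b ^ i) mod b)%nat A.
Proof.
unfold inB; rewrite Hmax; split.
- intros H i; destruct (Nat.eq_dec (n / b ^ i) 0) as [E|E].
  + rewrite E, Nat.Div0.mod_0_l, Nat.sub_0_r; apply fmax_in.
  + destruct (H i E) as [a [Ha Ea]]; rewrite Ea.
    assert (a < b)%nat by (exact (proj1 (Forall_forall _ _) HAb a Ha)).
    replace (b - 1 - (b - 1 - a))%nat with a by lia; exact Ha.
- intros H i _; exists (b - 1 - (n / b ^ i) mod b)%nat; split; [apply H|].
  assert ((n / b ^ i) mod b < b)%nat by (apply Nat.mod_upper_bound; lia); lia.
Qed.

Lemma inB_0 : inB b A 0.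
Proof. apply inB_alt; intros i; rewrite Nat.Div0.div_0_l, Nat.Div0.mod_0_l, Nat.sub_0_r; apply fmax_in. Qed.

(** Position l holds the digit d, possibly 0; the positions below agree with those of n, and those
    above are zero. *)
Lemma inB_block d n l : (d < b)%nat -> (n < b ^ l)%nat ->
  inB b A (d * b ^ l + n) <-> In (b - 1 - d)%nat A /\ inB b A n.
Proof.
intros Hd Hn; rewrite !inB_alt.
assert (Pp : forall i, (0 < b ^ i)%nat) by (intros; apply Nat.neq_0_lt_0, Nat.pow_nonzero; lia).
assert (lo : forall i, (i < l)%nat -> (((d * b ^ l + n) / b ^ i) mod b = (n / b ^ i) mod b)%nat).
{ intros i Hi.
  replace (d * b ^ l + n)%nat with (n + (d * b ^ (l - i - 1) * b) * b ^ i)%nat.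
  - rewrite Nat.div_add, Nat.Div0.mod_add by (generalize (Pp i); lia); reflexivity.
  - rewrite Nat.add_comm; f_equal.
    rewrite <- !Nat.mul_assoc; f_equal.
    rewrite <- Nat.pow_succ_r', <- Nat.pow_add_r; f_equal; lia. }
assert (mid : ((d * b ^ l + n) / b ^ l = d)%nat).
{ rewrite Nat.add_comm, Nat.div_add by (generalize (Pp l); lia).
  now rewrite Nat.div_small. }
assert (hi : forall i, (l < i)%nat -> ((d * b ^ l + n) / b ^ i = 0)%nat).
{ intros i Hi; apply Nat.div_small.
  apply Nat.lt_le_trans with (b ^ S l)%nat; [rewrite Nat.pow_succ_r'; nia|].
  apply Nat.pow_le_mono_r; lia. }
assert (hin : forall i, (l <= i)%nat -> (n / b ^ i = 0)%nat).
{ intros i Hi; apply Nat.div_small.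
  apply Nat.lt_le_trans with (b ^ l)%nat; [exact Hn|apply Nat.pow_le_mono_r; lia]. }
split.
- intros H; split.
  + specialize (H l); rewrite mid, Nat.mod_small in H by exact Hd; exact H.
  + intros i; destruct (le_lt_dec l i) as [Q|Q].
    * rewrite hin, Nat.Div0.mod_0_l, Nat.sub_0_r by exact Q; apply fmax_in.
    * rewrite <- lo by exact Q; apply H.
- intros [H1 H2] i; destruct (lt_eq_lt_dec i l) as [[Q|Q]|Q].
  + rewrite lo by exact Q; apply H2.
  + subst i; rewrite mid, Nat.mod_small by exact Hd; exact H1.
  + rewrite hi, Nat.Div0.mod_0_l, Nat.sub_0_r by exact Q; apply fmax_in.
Qed.

Lemma indB_block d n l : (d < b)%nat -> (n < b ^ l)%nat ->
  indB b A (d * b ^ l + n) = digit d * indB b A n.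
Proof.
intros Hd Hn; assert (H := inB_block d n l Hd Hn); unfold indB, digit.
destruct (excluded_middle_informative (inB b A (d * b ^ l + n)));
destruct (excluded_middle_informative (inB b A n));
destruct (in_dec Nat.eq_dec (b - 1 - d)%nat A); try ring; tauto.
Qed.

Lemma indB_0 : indB b A 0 = 1.
Proof.
unfold indB; destruct (excluded_middle_informative (inB b A 0)) as [_|H]; [reflexivity|].
exfalso; apply H, inB_0.
Qed.

Lemma indB_bounds n : 0 <= indB b A n <= 1.
Proof. unfold indB; destruct (excluded_middle_informative _); lra. Qed.

(** The first letter weighs most, so it becomes the leading digit. [H] is quantified inside the
    induction because prefixing a letter a replaces H by x -> H ((a + x) / b). *)
Lemma words_sum l : forall H : R -> R,
  lsum (map (fun w => H (xval b w)) (words A l)) =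
  nsum (fun n => indB b A n * H (1 - (INR n + 1) / INR b ^ l)) (b ^ l).
Proof.
assert (HB := b_pos b Hb).
induction l as [|l IH]; intros H.
- change (H 0 + 0 = 0 + indB b A 0 * H (1 - (0 + 1) / 1)).
  rewrite indB_0; replace (1 - (0 + 1) / 1) with 0 by field; ring.
- simpl words; rewrite lsum_flat_map.
  rewrite (map_ext _ (fun a => nsum (fun n => indB b A n *
            H ((INR a + (1 - (INR n + 1) / INR b ^ l)) / INR b)) (b ^ l))).
  2: { intros a; rewrite map_map; apply (IH (fun x => H ((INR a + x) / INR b))). }
  rewrite lsum_digits, Nat.pow_succ_r', nsum_blocks; apply nsum_ext; intros d Hd.
  rewrite <- nsum_scal; apply nsum_ext; intros n Hn.
  rewrite indB_block by assumption.
  rewrite Rmult_assoc; do 2 f_equal; f_equal.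
  rewrite plus_INR, mult_INR, pow_INR, !minus_INR by lia; simpl.
  field; split; [apply pow_nonzero|]; lra.
Qed.

Lemma lsum_const {T : Type} (c : R) (l : list T) : lsum (map (fun _ => c) l) = INR (length l) * c.
Proof.
induction l as [|x l IH]; [unfold lsum; simpl; ring|].
change (c + lsum (map (fun _ => c) l) = INR (S (length l)) * c).
rewrite IH, S_INR; ring.
Qed.

Lemma words_count l : lsum (map (fun _ => 1) (words A l)) = INR (length A) ^ l.
Proof.
induction l as [|l IH]; [unfold lsum; simpl; ring|].
simpl words; rewrite lsum_flat_map.
rewrite (map_ext _ (fun _ => INR (length A) ^ l)) by (intros; rewrite map_map; exact IH).
apply lsum_const.
Qed.

(** [words_sum] at a constant [H]. This growth fixes the abscissa log_b N of the Dirichlet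
    series. *)
Lemma count_B l : nsum (indB b A) (b ^ l) = INR (length A) ^ l.
Proof.
rewrite <- words_count, (words_sum l (fun _ => 1)); apply nsum_ext; intros; ring.
Qed.

Lemma length_A_pos : 1 <= INR (length A).
Proof.
assert (H := fmax_in); destruct A as [|a A']; [easy|].
simpl length; rewrite S_INR; generalize (pos_INR (length A')); lra.
Qed.

(** Modulus of the n-th term of the Dirichlet series at real part [p]. *)
Definition powB (p : R) (n : nat) : R := indB b A n * exp (- p * ln (INR n + 1)).

Lemma powB_nonneg p n : 0 <= powB p n.
Proof. apply Rmult_le_pos; [apply indB_bounds|left; apply exp_pos]. Qed.

(** At most N^(l + 1) elements of the digit set lie in [b^l, b^(l + 1)), each contributing at most
    b^(-p l): the blocks are dominated by a geometric series of ratio q = N b^(-p) < 1. *)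
Lemma ex_series_powB p : ln (INR (length A)) / ln (INR b) < p -> ex_series (powB p).
Proof.
intros Hp; assert (HL := ln_b_pos b Hb); assert (HN := length_A_pos).
assert (HB := b_pos b Hb).
set (N := INR (length A)) in *; set (L := ln (INR b)) in *.
assert (HlN : 0 <= ln N) by (rewrite <- ln_1; destruct HN as [HN|HN]; [left; apply ln_increasing; lra|rewrite <- HN; lra]).
assert (HpL : ln N < p * L).
{ replace (ln N) with (ln N / L * L) by (field; lra); apply Rmult_lt_compat_r; assumption. }
assert (Hp0 : 0 < p) by nra.
set (q := N * exp (- p * L)).
assert (Hq0 : 0 < q) by (apply Rmult_lt_0_compat; [lra|apply exp_pos]).
assert (Hq1 : q < 1).
{ unfold q; rewrite <- (exp_ln N) by lra; rewrite <- exp_plus, <- exp_0; apply exp_increasing; lra. }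
(* The 1 is the term n = 0, which precedes all blocks; the fraction sums the first l powers of q. *)
assert (Hbound : forall l, nsum (powB p) (b ^ l) <= 1 + N * ((1 - q ^ l) / (1 - q))).
{ induction l as [|l IH].
  - simpl; unfold powB; rewrite indB_0; simpl; rewrite !Rplus_0_l, ln_1, Rmult_0_r, exp_0.
    replace ((1 - 1) / (1 - q)) with 0 by (field; lra); lra.
  - assert (Hpw : (b ^ l <= b ^ S l)%nat) by (apply Nat.pow_le_mono_r; lia).
    replace (b ^ S l)%nat with (b ^ l + (b ^ S l - b ^ l))%nat by lia.
    rewrite nsum_split.
    assert (Hblk : nsum (fun k => powB p (b ^ l + k)) (b ^ S l - b ^ l) <= N * q ^ l).
    { apply Rle_trans with (nsum (fun k => exp (- p * L) ^ l * indB b A (b ^ l + k)) (b ^ S l - b ^ l)).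
      - apply nsum_le; intros k _; unfold powB; rewrite Rmult_comm.
        apply Rmult_le_compat_r; [apply indB_bounds|].
        rewrite <- exp_INR; apply exp_le_compat.
        assert (L * INR l <= ln (INR (b ^ l + k) + 1)).
        { rewrite Rmult_comm; unfold L; rewrite <- ln_pow by exact HB; rewrite <- pow_INR.
          left; apply ln_increasing.
          - apply lt_0_INR, Nat.neq_0_lt_0, Nat.pow_nonzero; lia.
          - rewrite plus_INR; generalize (pos_INR k); lra. }
        nra.
      - rewrite nsum_scal; unfold q; rewrite Rpow_mult_distr.
        rewrite (Rmult_comm (N ^ l)), <- Rmult_assoc, (Rmult_comm N), Rmult_assoc.
        apply Rmult_le_compat_l; [apply pow_le; left; apply exp_pos|].
        change (N * N ^ l) with (N ^ S l); unfold N; rewrite <- count_B.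
        replace (b ^ S l)%nat with (b ^ l + (b ^ S l - b ^ l))%nat at 2 by lia.
        rewrite (nsum_split _ (b ^ l)).
        assert (0 <= nsum (indB b A) (b ^ l)) by (apply nsum_nonneg; intros; apply indB_bounds); lra. }
    replace (N * ((1 - q ^ S l) / (1 - q))) with (N * ((1 - q ^ l) / (1 - q)) + N * q ^ l)
      by (simpl; field; lra).
    lra. }
apply ex_finite_lim_seq_incr with (M := 1 + N * (1 / (1 - q))).
- intros n; rewrite sum_Sn; generalize (powB_nonneg p (S n)); unfold plus; simpl; lra.
- intros n; change (psum (powB p) n <= 1 + N * (1 / (1 - q))); rewrite <- nsum_psum.
  eapply Rle_trans; [apply (nsum_mono _ (S n) (b ^ S n)); [apply powB_nonneg|]|].
  { apply Nat.lt_le_incl, Nat.pow_gt_lin_r; lia. }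
  eapply Rle_trans; [apply Hbound|].
  apply Rplus_le_compat_l, Rmult_le_compat_l; [lra|].
  apply Rmult_le_compat_r; [left; apply Rinv_0_lt_compat; lra|].
  generalize (pow_lt q (S n) Hq0); lra.
Qed.

End Digits.

(** * The profile *)

(* Legendre transform of exp: the maximum of q u - e^u is q ln q - q. *)
Lemma exp_legendre q u : 0 < q -> q * u - exp u <= q * ln q - q.
Proof.
intros Hq; assert (H := exp_ineq1_le (u - ln q)).
replace (exp u) with (q * exp (u - ln q)); [nra|].
rewrite <- (exp_ln q) at 1 by exact Hq; rewrite <- exp_plus; f_equal; ring.
Qed.

(** Derivatives up to order n exist and decay exponentially. They are given by witnesses, to which
    [Per_derive] applies at each order. *)
Fixpoint decn (n : nat) (f : R -> R) : Prop :=
  match n with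
  | O => expdec f
  | S n' => expdec f /\ exists g : R -> R, (forall t, is_derive f t (g t)) /\ decn n' g
  end.

Lemma decn_expdec n f : decn n f -> expdec f.
Proof. destruct n; simpl; tauto. Qed.

Lemma decn_scal c n : forall f, decn n f -> decn n (fun t => c * f t).
Proof.
induction n as [|n IH]; intros f; simpl; [apply expdec_scal|].
intros [Hf [g [Hd Hg]]]; split; [now apply expdec_scal|].
exists (fun t => c * g t); split; [intros t; now apply is_derive_scal|now apply IH].
Qed.

Lemma decn_plus n : forall f g, decn n f -> decn n g -> decn n (fun t => f t + g t).
Proof.
induction n as [|n IH]; intros f g; simpl; [apply expdec_plus|].
intros [Hf [f' [Hdf Hf']]] [Hg [g' [Hdg Hg']]]; split; [now apply expdec_plus|].
exists (fun t => f' t + g' t); split; [|now apply IH].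
intros t; exact (is_derive_plus f g t _ _ (Hdf t) (Hdg t)).
Qed.

Lemma Per_smooth n : forall f, decn n f -> forall t, ex_derive_n (Per f) n t.
Proof.
destruct n as [|n]; [intros; exact I|].
induction n as [|n IH]; intros f Hf t.
- destruct Hf as [Hf [g [Hd Hg]]]; exists (Per g t); apply Per_derive; trivial.
- destruct Hf as [Hf [g [Hd Hg]]].
  change (ex_derive (Derive_n (Per f) (S n)) t).
  apply ex_derive_ext with (Derive_n (Per g) n); [|apply (IH g Hg t)].
  intros x; rewrite <- Nat.add_1_r, <- Derive_n_comp; apply Derive_n_ext.
  intros y; symmetry; apply is_derive_unique, Per_derive; [exact Hf|now apply decn_expdec in Hg|exact Hd].
Qed.

Lemma Series_nonneg (a : nat -> R) : (forall n, 0 <= a n) -> ex_series a -> 0 <= Series a.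
Proof.
intros H Ha; replace 0 with (Series (fun _ => 0 * 0)) by (rewrite Series_scal_l; ring).
apply Series_le; [|exact Ha]; intros n; specialize (H n); lra.
Qed.

Section Profile.

Variables (b : nat) (A : list nat) (sigma : R).
Hypotheses (Hb : (2 <= b)%nat) (HAnd : NoDup A)
  (HAb : List.Forall (fun a => (a < b)%nat) A) (Hmax : fmax A = (b - 1)%nat)
  (Hs : ln (INR (length A)) / ln (INR b) < sigma).

Let L := ln (INR b).

(** The modulus b^(sigma t) e^(-(n + 1) b^t) of a term of Phi, multiplied by ((n + 1) b^t)^i. *)
Definition term (i n : nat) (t : R) : R :=
  indB b A n * ((INR n + 1) ^ i * exp (ln (INR b) * (sigma + INR i) * t - (INR n + 1) * exp (ln (INR b) * t))).

Definition profile (i : nat) (t : R) : R := Series (fun n => term i n t).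

Let Lpos : 0 < L := ln_b_pos b Hb.

Lemma abscissa_nonneg : 0 <= ln (INR (length A)) / ln (INR b).
Proof.
apply Rdiv_le_0_compat; [|exact Lpos].
destruct (length_A_pos b A Hb HAnd HAb Hmax) as [H|H]; [|rewrite <- H, ln_1; lra].
rewrite <- ln_1; left; apply ln_increasing; lra.
Qed.

Lemma term_nonneg i n t : 0 <= term i n t.
Proof.
apply Rmult_le_pos; [apply indB_bounds|].
apply Rmult_le_pos; [apply pow_le; left; apply INR1_pos|left; apply exp_pos].
Qed.

(* An exponent strictly between the abscissa of convergence and [sigma] leaves
   room for both summability in [n] and exponential decay in [t]. *)
Lemma term_bound : exists (a : nat -> R) (e : R), ex_series a /\ 0 < e /\ (forall n, 0 <= a n) /\
  forall i, exists C, 0 <= C /\ forall n t, Rabs (term i n t) <= a n * (C * exp (- e * Rabs t)).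
Proof.
set (p := (ln (INR (length A)) / ln (INR b) + sigma) / 2).
set (d := sigma - p).
assert (H0 := abscissa_nonneg).
assert (Hp : 0 < p) by (unfold p; lra).
assert (Hd : 0 < d) by (unfold d, p; lra).
exists (powB b A p), (L * d).
split; [apply ex_series_powB; trivial; unfold p; lra|].
split; [now apply Rmult_lt_0_compat|].
split; [intros; apply powB_nonneg|].
intros i.
set (q := p + INR i); assert (Hq : 0 < q) by (unfold q; generalize (pos_INR i); lra).
set (K := fun q => q * ln q - q).
exists (exp (K q) + exp (K (q + 2 * d))); split.
{ generalize (exp_pos (K q)) (exp_pos (K (q + 2 * d))); lra. }
intros n t; rewrite Rabs_pos_eq by apply term_nonneg.
unfold term, powB; rewrite (Rmult_assoc (indB b A n) (exp _)); apply Rmult_le_compat_l; [apply indB_bounds|].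
assert (Hnu := INR1_pos n); set (nu := INR n + 1) in *.
assert (Hl0 : 0 <= ln nu).
{ unfold nu; destruct n as [|n]; [simpl; rewrite Rplus_0_l, ln_1; lra|].
  rewrite <- ln_1; left; apply ln_increasing; [lra|].
  rewrite S_INR; generalize (pos_INR n); lra. }
assert (Epow : nu ^ i = exp (ln nu * INR i)) by (rewrite exp_INR, exp_ln; trivial).
assert (Emul : nu * exp (L * t) = exp (ln nu + L * t)) by (rewrite exp_plus, exp_ln; trivial).
fold L; rewrite Epow, Emul, <- exp_plus.
(* In terms of u the exponent is q u - e^u - p ln nu + L d t. For t <= 0 the last summand already
   decays; for t > 0, raising q by 2 d turns it into -L d t, at the harmless cost -2 d ln nu <=
   0. *)
set (u := ln nu + L * t).
rewrite (Rmult_plus_distr_r (exp (K q))), (Rmult_plus_distr_l (exp (- p * ln nu))), <- !exp_plus.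
destruct (Rle_lt_dec t 0) as [Ht|Ht].
- rewrite (Rabs_left1 t) by exact Ht.
  match goal with |- ?x <= ?y + ?z => assert (0 < z) by apply exp_pos; apply Rle_trans with y; [|lra] end.
  apply exp_le_compat.
  assert (Q := exp_legendre q u Hq); fold (K q) in Q.
  assert (E : L * (sigma + INR i) * t + ln nu * INR i = q * u - p * ln nu + L * d * t)
    by (unfold q, u, d; ring).
  lra.
- rewrite (Rabs_pos_eq t) by lra.
  match goal with |- ?x <= ?y + ?z => assert (0 < y) by apply exp_pos; apply Rle_trans with z; [|lra] end.
  apply exp_le_compat.
  assert (Q := exp_legendre (q + 2 * d) u ltac:(lra)); fold (K (q + 2 * d)) in Q.
  assert (E : L * (sigma + INR i) * t + ln nu * INR i =
     (q + 2 * d) * u - p * ln nu - L * d * t - 2 * d * ln nu) by (unfold q, u, d; ring).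
  assert (0 <= d * ln nu) by (apply Rmult_le_pos; lra).
  lra.
Qed.

(** Differentiating e^(-(n + 1) b^t) brings down (n + 1) b^t, which is the passage from [i] to
    [S i]: the family is closed under derivatives. *)
Lemma term_derive i n t :
  is_derive (term i n) t (L * ((sigma + INR i) * term i n t - term (S i) n t)).
Proof.
unfold term; fold L; auto_derive; [exact I|].
rewrite S_INR; simpl pow.
replace (L * (sigma + (INR i + 1)) * t - (INR n + 1) * exp (L * t)) with
  (L * t + (L * (sigma + INR i) * t - (INR n + 1) * exp (L * t))) by ring.
rewrite (exp_plus (L * t)).
replace (L * (sigma + INR i) * t + - ((INR n + 1) * exp (L * t))) with
  (L * (sigma + INR i) * t - (INR n + 1) * exp (L * t)) by ring.
ring.
Qed.

Lemma term_cont i n : cont (term i n).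
Proof. exact (cont_derive _ _ (term_derive i n)). Qed.

Lemma exp_decay_le_1 e t : 0 < e -> exp (- e * Rabs t) <= 1.
Proof.
intros He; rewrite <- exp_0; apply exp_le_compat; generalize (Rabs_pos t); nra.
Qed.

Lemma term_locdom i : locdom (term i).
Proof.
destruct term_bound as [a [e [Ha [He [Ha0 H]]]]]; destruct (H i) as [C [HC HB]].
intros T; exists (fun n => C * a n); split; [now apply (ex_series_scal (V := R_NormedModule))|].
intros n t _; eapply Rle_trans; [apply HB|].
rewrite (Rmult_comm C (a n)); apply Rmult_le_compat_l; [apply Ha0|].
rewrite <- (Rmult_1_r C) at 2; apply Rmult_le_compat_l; [exact HC|now apply exp_decay_le_1].
Qed.

Lemma ex_series_term i t : ex_series (fun n => term i n t).
Proof. apply locdom_ex, term_locdom. Qed.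

Lemma term_expdec i n : expdec (term i n).
Proof.
destruct term_bound as [a [e [Ha [He [Ha0 H]]]]]; destruct (H i) as [C [HC HB]].
split; [apply term_cont|].
exists (a n * C), e; split; [now apply Rmult_le_pos|split; [exact He|]].
intros t; rewrite Rmult_assoc; apply HB.
Qed.

Lemma profile_expdec i : expdec (profile i).
Proof.
destruct term_bound as [a [e [Ha [He [Ha0 H]]]]]; destruct (H i) as [C [HC HB]].
split; [apply Series_cont; [apply term_locdom|apply term_cont]|].
exists (Series a * C), e; split; [|split; [exact He|]].
- apply Rmult_le_pos; [|exact HC].
  apply Rle_trans with (Rabs (Series a)); [apply Rabs_pos|].
  apply Series_abs_le; [|exact Ha]; intros n; rewrite Rabs_pos_eq by apply Ha0; lra.
- intros t; rewrite Rmult_assoc, <- Series_scal_r.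
  apply Series_abs_le; [intros; apply HB|now apply ex_series_scal_r].
Qed.

Lemma profile_nonneg i t : 0 <= profile i t.
Proof.
apply Series_nonneg; [intros n; apply term_nonneg|apply ex_series_term].
Qed.

Lemma profile_derive i t :
  is_derive (profile i) t (L * ((sigma + INR i) * profile i t - profile (S i) t)).
Proof.
unfold profile; rewrite <- Series_scal_l, <- Series_minus, <- Series_scal_l;
  [|apply (ex_series_scal (V := R_NormedModule)), ex_series_term|apply ex_series_term].
apply (Series_is_derive (term i) (fun n t => L * ((sigma + INR i) * term i n t - term (S i) n t))).
- apply term_locdom.
- intros T; destruct (term_locdom i T) as [a [Ha Ba]]; destruct (term_locdom (S i) T) as [c [Hc Bc]].
  exists (fun n => L * Rabs (sigma + INR i) * a n + L * c n); split.
  + apply (ex_series_plus (V := R_NormedModule)); now apply (ex_series_scal (V := R_NormedModule)).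
  + intros n x Hx; rewrite Rabs_mult, (Rabs_pos_eq L) by lra.
    rewrite Rmult_assoc, <- Rmult_plus_distr_l; apply Rmult_le_compat_l; [lra|].
    unfold Rminus; eapply Rle_trans; [apply Rabs_triang|].
    rewrite Rabs_mult, Rabs_Ropp; apply Rplus_le_compat; [|now apply Bc].
    apply Rmult_le_compat_l; [apply Rabs_pos|now apply Ba].
- intros n; apply cont_scal, (cont_plus (fun t => (sigma + INR i) * term i n t) (fun t => - term (S i) n t));
   [apply cont_scal, term_cont|].
  intros x; apply (continuous_opp (term (S i) n)), term_cont.
- intros n x; apply term_derive.
Qed.

Variable omega : R.

(** For i = 0, sigma = Re s and omega = Im s, this and [profile_sin] are the real and imaginary
    parts of Phi. *)
Definition profile_cos (i : nat) (t : R) : R := profile i t * cos (ln (INR b) * omega * t).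
Definition profile_sin (i : nat) (t : R) : R := profile i t * sin (ln (INR b) * omega * t).

Lemma cont_cos_scal k : cont (fun v => cos (k * v)).
Proof. intros v; apply continuous_ext with (fun v => cos (k * v + 0)); [intros; now rewrite Rplus_0_r|apply cont_cos_lin]. Qed.

Lemma cont_sin_scal k : cont (fun v => sin (k * v)).
Proof. intros v; apply continuous_ext with (fun v => sin (k * v + 0)); [intros; now rewrite Rplus_0_r|apply cont_sin_lin]. Qed.

Lemma profile_cos_expdec i : expdec (profile_cos i).
Proof. apply expdec_mult with 1; [apply profile_expdec|apply cont_cos_scal|intros; apply Rabs_cos_le]. Qed.

Lemma profile_sin_expdec i : expdec (profile_sin i).
Proof. apply expdec_mult with 1; [apply profile_expdec|apply cont_sin_scal|intros; apply Rabs_sin_le]. Qed.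

Lemma profile_trig_derive i t :
  is_derive (profile_cos i) t
    (L * (sigma + INR i) * profile_cos i t + - L * profile_cos (S i) t + - (L * omega) * profile_sin i t) /\
  is_derive (profile_sin i) t
    (L * (sigma + INR i) * profile_sin i t + - L * profile_sin (S i) t + L * omega * profile_cos i t).
Proof.
split; unfold profile_cos, profile_sin; fold L; evar_last.
- apply (is_derive_mult (profile i) (fun t => cos (L * omega * t)) t (L * ((sigma + INR i) * profile i t - profile (S i) t)) (- (L * omega * sin (L * omega * t)))).
  + apply profile_derive.
  + auto_derive; [exact I|ring].
  + intros; apply Rmult_comm.
- unfold plus, mult; simpl; ring.
- apply (is_derive_mult (profile i) (fun t => sin (L * omega * t)) t (L * ((sigma + INR i) * profile i t - profile (S i) t)) (L * omega * cos (L * omega * t))).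
  + apply profile_derive.
  + auto_derive; [exact I|ring].
  + intros; apply Rmult_comm.
- unfold plus, mult; simpl; ring.
Qed.

(** Proved for both functions and all [i] at once, since each derivative mixes cosine and sine and
    raises [i]. *)
Lemma profile_trig_decn n : forall i, decn n (profile_cos i) /\ decn n (profile_sin i).
Proof.
induction n as [|n IH]; intros i.
- split; [apply profile_cos_expdec|apply profile_sin_expdec].
- split; [split; [apply profile_cos_expdec|]|split; [apply profile_sin_expdec|]].
  + exists (fun t => L * (sigma + INR i) * profile_cos i t + - L * profile_cos (S i) t + - (L * omega) * profile_sin i t).
    split; [intros t; apply profile_trig_derive|].
    apply (decn_plus n (fun t => L * (sigma + INR i) * profile_cos i t + - L * profile_cos (S i) t)
      (fun t => - (L * omega) * profile_sin i t)); [|now apply decn_scal, IH].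
    apply (decn_plus n (fun t => L * (sigma + INR i) * profile_cos i t)); now apply decn_scal, IH.
  + exists (fun t => L * (sigma + INR i) * profile_sin i t + - L * profile_sin (S i) t + L * omega * profile_cos i t).
    split; [intros t; apply profile_trig_derive|].
    apply (decn_plus n (fun t => L * (sigma + INR i) * profile_sin i t + - L * profile_sin (S i) t)
      (fun t => L * omega * profile_cos i t)); [|now apply decn_scal, IH].
    apply (decn_plus n (fun t => L * (sigma + INR i) * profile_sin i t)); now apply decn_scal, IH.
Qed.

End Profile.

(** * Gamma and the Fourier coefficients *)

Lemma cpow_pos x z : 0 < x ->
  cpow x z = (exp (Re z * ln x) * cos (Im z * ln x), exp (Re z * ln x) * sin (Im z * ln x)).
Proof. intros Hx; unfold cpow; destruct (Rlt_dec 0 x); [reflexivity|easy]. Qed.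

Lemma C_eq (z w : C) : Re z = Re w -> Im z = Im w -> z = w.
Proof. destruct z, w; simpl; intros; now f_equal. Qed.

(* The substitution t = e^{L v} in Euler's integral. *)
Lemma Gamma_integral L (z : C) a b : 0 < L -> 0 < a -> 0 < b ->
  is_RInt (V := C_R_NormedModule) (fun t : R => (cpow t (z - 1) * RtoC (exp (- t)))%C) a b
    (RInt (fun v => L * (exp (L * Re z * v - exp (L * v)) * cos (L * Im z * v))) (ln a / L) (ln b / L),
     RInt (fun v => L * (exp (L * Re z * v - exp (L * v)) * sin (L * Im z * v))) (ln a / L) (ln b / L)).
Proof.
intros HL Ha Hb.
assert (Hpos : forall x, Rmin a b <= x -> 0 < x).
{ intros x; apply Rlt_le_trans, Rmin_glb_lt; assumption. }
assert (Hg : forall x, Rmin a b <= x <= Rmax a b ->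
  is_derive (fun t => ln t / L) x (/ (L * x)) /\ continuous (fun x => / (L * x)) x).
{ intros x [Hx _]; specialize (Hpos x Hx); split.
  - auto_derive; [exact Hpos|field; lra].
  - apply (ex_derive_continuous (fun x => / (L * x))); auto_derive.
    assert (0 < L * x) by (now apply Rmult_lt_0_compat); lra. }
assert (Key : forall g : R -> R, cont g ->
  is_RInt (fun t => exp ((Re z - 1) * ln t) * exp (- t) * g (ln t)) a b
    (RInt (fun v => L * (exp (L * Re z * v - exp (L * v)) * g (L * v))) (ln a / L) (ln b / L))).
{ intros g Hgc.
  assert (Hc : cont (fun v => L * (exp (L * Re z * v - exp (L * v)) * g (L * v)))).
  { apply cont_scal, cont_mult.
    - apply (cont_derive _ (fun v => (L * Re z - L * exp (L * v)) * exp (L * Re z * v - exp (L * v)))).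
      intros t; auto_derive; [exact I|].
      replace (L * Re z * t + - exp (L * t)) with (L * Re z * t - exp (L * t)) by ring; ring.
    - apply (cont_comp g (fun v => L * v)); [exact Hgc|]; apply cont_scal; intros t; apply continuous_id. }
  eapply is_RInt_ext; [|apply (is_RInt_comp (V := R_CompleteNormedModule) _ (fun t => ln t / L) _ a b (fun x _ => Hc _) Hg)].
  intros x [Hx _]; specialize (Hpos x (Rlt_le _ _ Hx)).
  unfold scal; simpl; unfold mult; simpl.
  replace (L * (ln x / L)) with (ln x) by (field; lra).
  replace (L * Re z * (ln x / L)) with (Re z * ln x) by (field; lra).
  rewrite exp_ln by exact Hpos.
  rewrite <- exp_plus.
  replace (Re z * ln x - x) with (((Re z - 1) * ln x + - x) + ln x) by ring.
  rewrite (exp_plus _ (ln x)), (exp_ln x) by exact Hpos; field; lra. }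
assert (Pos : forall x, Rmin a b < x < Rmax a b -> 0 < x).
{ intros x [Hx _]; apply Hpos; lra. }
apply (is_RInt_fct_extend_pair (U := R_NormedModule) (V := R_NormedModule)).
- apply (is_RInt_ext (fun t => exp ((Re z - 1) * ln t) * exp (- t) * cos (Im z * ln t))).
  + intros x Hx; rewrite cpow_pos by (now apply Pos); simpl; change (fst z) with (Re z); change (snd z) with (Im z).
    replace (Im z + - 0) with (Im z) by ring; replace (Re z + - (1)) with (Re z - 1) by ring; rring.
  + evar_last; [apply (Key (fun u => cos (Im z * u)) (cont_cos_scal _))|].
    apply RInt_ext; intros x _; rewrite (Rmult_comm L (Im z)), (Rmult_assoc (Im z)); reflexivity.
- apply (is_RInt_ext (fun t => exp ((Re z - 1) * ln t) * exp (- t) * sin (Im z * ln t))).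
  + intros x Hx; rewrite cpow_pos by (now apply Pos); simpl; change (fst z) with (Re z); change (snd z) with (Im z).
    replace (Im z + - 0) with (Im z) by ring; replace (Re z + - (1)) with (Re z - 1) by ring; rring.
  + evar_last; [apply (Key (fun u => sin (Im z * u)) (cont_sin_scal _))|].
    apply RInt_ext; intros x _; rewrite (Rmult_comm L (Im z)), (Rmult_assoc (Im z)); reflexivity.
Qed.

(** The decay hypothesis amounts to Re z > 0, the domain of convergence of Euler's integral. *)
Lemma CGamma_RIntR L (z : C) : 0 < L ->
  expdec (fun v => exp (L * Re z * v - exp (L * v))) ->
  CGamma z = (L * RIntR (fun v => exp (L * Re z * v - exp (L * v)) * cos (L * Im z * v)),
              L * RIntR (fun v => exp (L * Re z * v - exp (L * v)) * sin (L * Im z * v))).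
Proof.
intros HL HE.
assert (Hc : expdec (fun v => exp (L * Re z * v - exp (L * v)) * cos (L * Im z * v))).
{ apply expdec_mult with 1; [exact HE|apply cont_cos_scal|intros; apply Rabs_cos_le]. }
assert (Hs : expdec (fun v => exp (L * Re z * v - exp (L * v)) * sin (L * Im z * v))).
{ apply expdec_mult with 1; [exact HE|apply cont_sin_scal|intros; apply Rabs_sin_le]. }
rewrite <- (RIntR_scal L _ Hc), <- (RIntR_scal L _ Hs).
unfold CGamma.
match goal with |- _ = ?l => apply (@is_RInt_gen_unique C_R_CompleteNormedModule (at_right 0)
  (Rbar_locally p_infty) _ _ _ l) end.
intros P [eps HP].
destruct (RIntR_lim _ (expdec_scal L _ Hc) eps (cond_pos eps)) as [M1 H1].
destruct (RIntR_lim _ (expdec_scal L _ Hs) eps (cond_pos eps)) as [M2 H2].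
set (M := Rmax M1 M2).
(* The substitution t = e^(L v) sends these cut points beyond -M and M. *)
exists (fun a => 0 < a < exp (- (M * L))) (fun b => exp (M * L) < b).
- exists (mkposreal _ (exp_pos (- (M * L)))); intros y Hy Hy0; split; [exact Hy0|].
  change (Rabs (y - 0) < exp (- (M * L))) in Hy; rewrite Rminus_0_r, Rabs_pos_eq in Hy; lra.
- exists (exp (M * L)); trivial.
- intros a b [Ha Ha'] Hb; simpl.
  assert (Hb0 : 0 < b) by (eapply Rlt_trans; [apply exp_pos|exact Hb]).
  eexists; split; [apply (Gamma_integral L z a b HL Ha Hb0)|].
  assert (La : ln a / L <= - M).
  { apply Rmult_le_reg_r with L; [exact HL|].
    replace (ln a / L * L) with (ln a) by (field; lra).
    rewrite <- Ropp_mult_distr_l, <- (ln_exp (- (M * L))); left; now apply ln_increasing. }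
  assert (Lb : M <= ln b / L).
  { apply Rmult_le_reg_r with L; [exact HL|].
    replace (ln b / L * L) with (ln b) by (field; lra).
    rewrite <- (ln_exp (M * L)); left; apply ln_increasing; [apply exp_pos|exact Hb]. }
  assert (M1 <= M) by apply Rmax_l; assert (M2 <= M) by apply Rmax_r.
  apply HP; split.
  + apply H1; lra.
  + apply H2; lra.
Qed.

Section Fourier.

Variables (b : nat) (A : list nat) (s : C).
Hypotheses (Hb : (2 <= b)%nat) (HAnd : NoDup A)
  (HAb : List.Forall (fun a => (a < b)%nat) A) (Hmax : fmax A = (b - 1)%nat)
  (Hs : ln (INR (length A)) / ln (INR b) < Re s).

Let L := ln (INR b).
Let Lpos : 0 < L := ln_b_pos b Hb.

(** The kernel of Gamma is the term n = 0 of the profile, since 0 lies in the digit set; its decay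
    is thus already known. *)
Lemma kernel_expdec : expdec (fun v => exp (L * Re s * v - exp (L * v))).
Proof.
eapply expdec_ext; [|exact (term_expdec b A (Re s) Hb HAnd HAb Hmax Hs 0 0)].
intros t; unfold term; rewrite indB_0 by assumption; simpl; fold L.
rewrite Rplus_0_r, Rplus_0_l, !Rmult_1_l; reflexivity.
Qed.

Lemma term_kernel n t :
  term b A (Re s) 0 n t =
  powB b A (Re s) n * exp (L * Re s * (t + ln (INR n + 1) / L) - exp (L * (t + ln (INR n + 1) / L))).
Proof.
unfold term, powB; fold L; simpl pow; simpl INR.
replace (L * (t + ln (INR n + 1) / L)) with (ln (INR n + 1) + L * t) by (field; lra).
replace (L * Re s * (t + ln (INR n + 1) / L)) with (Re s * ln (INR n + 1) + L * Re s * t) by (field; lra).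
rewrite (exp_plus (ln (INR n + 1)) (L * t)), exp_ln by apply INR1_pos.
rewrite (Rmult_assoc (indB b A n)), <- exp_plus, Rmult_1_l; do 2 f_equal; ring.
Qed.

Lemma kernel_cos_expdec th : expdec (fun v => exp (L * Re s * v - exp (L * v)) * cos (th * v)).
Proof. apply expdec_mult with 1; [exact kernel_expdec|apply cont_cos_scal|intros; apply Rabs_cos_le]. Qed.

Lemma kernel_sin_expdec th : expdec (fun v => exp (L * Re s * v - exp (L * v)) * sin (th * v)).
Proof. apply expdec_mult with 1; [exact kernel_expdec|apply cont_sin_scal|intros; apply Rabs_sin_le]. Qed.

Lemma RIntR_kernel_cos th c :
  RIntR (fun v => exp (L * Re s * v - exp (L * v)) * cos (th * v + c)) =
  cos c * RIntR (fun v => exp (L * Re s * v - exp (L * v)) * cos (th * v)) -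
  sin c * RIntR (fun v => exp (L * Re s * v - exp (L * v)) * sin (th * v)).
Proof.
assert (Hc := kernel_cos_expdec th); assert (Hn := kernel_sin_expdec th).
unfold Rminus at 2; rewrite Ropp_mult_distr_l, <- (RIntR_scal (cos c) _ Hc), <- (RIntR_scal (- sin c) _ Hn).
rewrite <- RIntR_plus by (now apply expdec_scal).
apply RIntR_ext; intros v; rewrite cos_plus; ring.
Qed.

Lemma RIntR_kernel_sin th c :
  RIntR (fun v => exp (L * Re s * v - exp (L * v)) * sin (th * v + c)) =
  sin c * RIntR (fun v => exp (L * Re s * v - exp (L * v)) * cos (th * v)) +
  cos c * RIntR (fun v => exp (L * Re s * v - exp (L * v)) * sin (th * v)).
Proof.
assert (Hc := kernel_cos_expdec th); assert (Hn := kernel_sin_expdec th).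
rewrite <- (RIntR_scal (sin c) _ Hc), <- (RIntR_scal (cos c) _ Hn).
rewrite <- RIntR_plus by (now apply expdec_scal).
apply RIntR_ext; intros v; rewrite sin_plus; ring.
Qed.

Lemma profile_RIntR_Series (p : R -> R) : cont p -> (forall t, Rabs (p t) <= 1) ->
  is_series (fun n => powB b A (Re s) n *
      RIntR (fun v => exp (L * Re s * v - exp (L * v)) * p (v - ln (INR n + 1) / L)))
    (RIntR (fun u => profile b A (Re s) 0 u * p u)).
Proof.
intros Hpc Hp.
destruct (term_bound b A (Re s) Hb HAnd HAb Hmax Hs) as [a [e [Ha [He [Ha0 H]]]]].
destruct (H 0%nat) as [C0 [HC0 HB]].
assert (HE := kernel_expdec).
eapply is_series_ext; [|apply (is_series_ext (fun n => RIntR (fun u => term b A (Re s) 0 n u * p u)));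
  [intros; reflexivity|]].
- intros n; cbv beta.
  set (tau := ln (INR n + 1) / L).
  assert (Hsh : expdec (fun v => exp (L * Re s * v - exp (L * v)) * p (v - tau))).
  { apply expdec_mult with 1; [exact HE|now apply (cont_shift p (- tau))|intros; apply Hp]. }
  rewrite <- (RIntR_shift _ tau Hsh), <- RIntR_scal by (now apply (expdec_shift _ tau Hsh)).
  apply RIntR_ext; intros u; rewrite term_kernel; fold tau.
  replace (u + tau - tau) with u by ring; ring.
- evar_last.
  + apply (RIntR_Series (fun n u => term b A (Re s) 0 n u * p u) a (fun t => C0 * exp (- e * Rabs t))).
    * intros n; apply expdec_mult with 1; trivial; now apply term_expdec.
    * split.
      -- apply cont_scal, (cont_comp exp (fun t => - e * Rabs t)).
         ++ intros x; apply (ex_derive_continuous exp); auto_derive; exact I.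
         ++ apply cont_scal; intros x; apply (continuous_abs x).
      -- exists C0, e; split; [exact HC0|split; [exact He|]]; intros t.
         rewrite Rabs_pos_eq; [lra|]; apply Rmult_le_pos; [exact HC0|left; apply exp_pos].
    * exact Ha.
    * intros t; apply Rmult_le_pos; [exact HC0|left; apply exp_pos].
    * eapply expdec_ext; [|apply (expdec_mult (profile b A (Re s) 0) p 1); trivial; now apply profile_expdec].
      intros t; unfold profile; now rewrite <- Series_scal_r.
    * intros n t; rewrite Rabs_mult, <- (Rmult_1_r (a n * _)).
      apply Rmult_le_compat; auto using Rabs_pos.
  + apply RIntR_ext; intros u; unfold profile; now rewrite <- Series_scal_r.
Qed.

(* The k-th Fourier term: exchanging the sum over n with the integral and
   translating by log_b (n+1) separates Gamma from the Dirichlet series. *)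
Lemma fourier_term kap t :
  let w := (s - RtoC (kap / L) * Ci)%C in
  (RtoC (/ L) * cis (kap * t) * CGamma w * sumB b A w)%C =
  (RIntR (fun u => profile b A (Re s) 0 u * cos ((L * Im s - kap) * u + kap * t)),
   RIntR (fun u => profile b A (Re s) 0 u * sin ((L * Im s - kap) * u + kap * t))).
Proof.
intros w; set (th := L * Im s - kap).
assert (Rw : Re w = Re s) by (unfold w, Re; simpl; ring).
assert (Iw : L * Im w = th) by (unfold w, th, Im; simpl; field; lra).
(* From here w enters only through its real part and [L * Im w = th]. *)
clearbody w.
assert (HE := kernel_expdec).
rewrite (CGamma_RIntR L w Lpos) by (rewrite Rw; exact HE).
rewrite Rw, Iw.
set (Gc := RIntR (fun v => exp (L * Re s * v - exp (L * v)) * cos (th * v))).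
set (Gs := RIntR (fun v => exp (L * Re s * v - exp (L * v)) * sin (th * v))).
set (P := Series (fun n => powB b A (Re s) n * cos (th * (ln (INR n + 1) / L)))).
set (Q := Series (fun n => powB b A (Re s) n * sin (th * (ln (INR n + 1) / L)))).
assert (EP : forall f : nat -> R, (forall n, Rabs (f n) <= 1) -> ex_series (fun n => powB b A (Re s) n * f n)).
{ intros f Hf; apply ex_series_dom with (powB b A (Re s)).
  - intros n; rewrite Rabs_mult, (Rabs_pos_eq (powB b A (Re s) n)) by apply powB_nonneg.
    rewrite <- (Rmult_1_r (powB b A (Re s) n)) at 2.
    apply Rmult_le_compat_l; [apply powB_nonneg|apply Hf].
  - now apply ex_series_powB. }
assert (HP : is_series (fun n => powB b A (Re s) n * cos (th * (ln (INR n + 1) / L))) P)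
  by (apply Series_correct, EP; intros; apply Rabs_cos_le).
assert (HQ : is_series (fun n => powB b A (Re s) n * sin (th * (ln (INR n + 1) / L))) Q)
  by (apply Series_correct, EP; intros; apply Rabs_sin_le).
assert (ES : sumB b A w = (P, - Q)).
{ unfold sumB, CSeries, P, Q; apply C_eq; simpl.
  - apply Series_ext; intros n; rewrite cpow_pos by apply INR1_pos; simpl; unfold powB.
    change (fst w) with (Re w); change (snd w) with (Im w); rewrite Rw.
    replace (- Im w * ln (INR n + 1)) with (- (th * (ln (INR n + 1) / L))) by (rewrite <- Iw; field; lra).
    rewrite cos_neg; ring.
  - rewrite <- Series_opp; apply Series_ext; intros n; rewrite cpow_pos by apply INR1_pos; simpl; unfold powB.
    change (fst w) with (Re w); change (snd w) with (Im w); rewrite Rw.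
    replace (- Im w * ln (INR n + 1)) with (- (th * (ln (INR n + 1) / L))) by (rewrite <- Iw; field; lra).
    rewrite sin_neg; ring. }
rewrite ES.
(* The right side is the real part of e^(i kap t) (Gc + i Gs) (P - i Q); [Is] is the imaginary
   part. *)
assert (Ic : RIntR (fun u => profile b A (Re s) 0 u * cos (th * u + kap * t)) =
  cos (kap * t) * (Gc * P + Gs * Q) + sin (kap * t) * (Gc * Q - Gs * P)).
{ assert (S1 := profile_RIntR_Series (fun u => cos (th * u + kap * t)) (cont_cos_lin _ _) (fun _ => Rabs_cos_le _)).
  apply is_series_unique in S1; rewrite <- S1; apply is_series_unique.
  evar_last.
  - eapply is_series_ext; [|exact (is_series_plus (V := R_NormedModule) _ _ _ _
      (is_series_scal (V := R_NormedModule) (cos (kap * t) * Gc + - (sin (kap * t) * Gs)) _ _ HP)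
      (is_series_scal (V := R_NormedModule) (cos (kap * t) * Gs + sin (kap * t) * Gc) _ _ HQ))].
    intros n; cbv beta.
    rewrite (RIntR_ext _ (fun v => exp (L * Re s * v - exp (L * v)) * cos (th * v + (kap * t - th * (ln (INR n + 1) / L))))).
    + rewrite RIntR_kernel_cos; fold Gc Gs; rewrite cos_minus, sin_minus.
      unfold plus, scal; simpl; unfold mult; simpl; rring.
    + intros v; do 2 f_equal; ring.
  - unfold plus, scal; simpl; unfold mult; simpl; rring. }
assert (Is : RIntR (fun u => profile b A (Re s) 0 u * sin (th * u + kap * t)) =
  sin (kap * t) * (Gc * P + Gs * Q) - cos (kap * t) * (Gc * Q - Gs * P)).
{ assert (S1 := profile_RIntR_Series (fun u => sin (th * u + kap * t)) (cont_sin_lin _ _) (fun _ => Rabs_sin_le _)).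
  apply is_series_unique in S1; rewrite <- S1; apply is_series_unique.
  evar_last.
  - eapply is_series_ext; [|exact (is_series_plus (V := R_NormedModule) _ _ _ _
      (is_series_scal (V := R_NormedModule) (sin (kap * t) * Gc + cos (kap * t) * Gs) _ _ HP)
      (is_series_scal (V := R_NormedModule) (sin (kap * t) * Gs + - (cos (kap * t) * Gc)) _ _ HQ))].
    intros n; cbv beta.
    rewrite (RIntR_ext _ (fun v => exp (L * Re s * v - exp (L * v)) * sin (th * v + (kap * t - th * (ln (INR n + 1) / L))))).
    + rewrite RIntR_kernel_sin; fold Gc Gs; rewrite cos_minus, sin_minus.
      unfold plus, scal; simpl; unfold mult; simpl; rring.
    + intros v; do 2 f_equal; ring.
  - unfold plus, scal; simpl; unfold mult; simpl; rring. }
rewrite Ic, Is; unfold cis; apply C_eq; simpl; field; lra.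
Qed.

End Fourier.

(** * The limit function *)

Lemma filterlim_C (a : nat -> C) (l : C) :
  (forall eps, 0 < eps -> exists N, forall n, (N <= n)%nat ->
     Rabs (Re (a n) - Re l) < eps /\ Rabs (Im (a n) - Im l) < eps) ->
  filterlim a eventually (@locally C_UniformSpace l).
Proof.
intros H; apply (filterlim_locally (U := C_UniformSpace)); intros eps.
destruct (H eps (cond_pos eps)) as [N HN]; exists N; intros n Hn.
exact (HN n Hn).
Qed.

Lemma sum_n_C (a : nat -> C) n :
  @sum_n C_AbelianMonoid a n = (psum (fun k => Re (a k)) n, psum (fun k => Im (a k)) n).
Proof.
induction n as [|n IH].
- rewrite sum_O, !psum_O; now destruct (a 0%nat).
- rewrite sum_Sn, IH, !psum_Sn; reflexivity.
Qed.

Lemma is_series_C (a : nat -> C) (l : C) :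
  is_series (fun n => Re (a n)) (Re l) -> is_series (fun n => Im (a n)) (Im l) ->
  is_series (K := C_AbsRing) (V := C_NormedModule) a l.
Proof.
intros H1 H2; apply filterlim_C; intros eps He.
destruct (proj1 (is_series_eps _ _) H1 eps He) as [N1 HN1].
destruct (proj1 (is_series_eps _ _) H2 eps He) as [N2 HN2].
exists (N1 + N2)%nat; intros n Hn.
change (Rabs (Re (@sum_n C_AbelianMonoid a n) - Re l) < eps /\
        Rabs (Im (@sum_n C_AbelianMonoid a n) - Im l) < eps).
rewrite sum_n_C.
split; [apply HN1|apply HN2]; lia.
Qed.

(** The unfolding, immediate because [RIntR] is itself defined by periodization. *)
Lemma RInt_Per_mult f p : periodic p ->
  RInt (fun u => Per f u * p u) 0 1 = RIntR (fun u => f u * p u).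
Proof. intros Hp; unfold RIntR; apply RInt_ext; intros; symmetry; now apply Per_mult_periodic. Qed.

Section Main.

Variables (b : nat) (A : list nat) (s : C).
Hypotheses (Hb : (2 <= b)%nat) (HAnd : NoDup A)
  (HAb : List.Forall (fun a => (a < b)%nat) A) (Hmax : fmax A = (b - 1)%nat)
  (Hs : ln (INR (length A)) / ln (INR b) < Re s).

Let L := ln (INR b).
Let Lpos : 0 < L := ln_b_pos b Hb.

(** Here t = log_b m. The limit is defined as the periodization and not by its Fourier series, since
    periodicity, smoothness and the second expression are read off from it. *)
Definition Fre (t : R) : R := Per (profile_cos b A (Re s) (Im s) 0) t.
Definition Fim (t : R) : R := Per (profile_sin b A (Re s) (Im s) 0) t.

Let Dc : expdec (profile_cos b A (Re s) (Im s) 0).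
Proof. now apply profile_cos_expdec. Qed.

Let Ds : expdec (profile_sin b A (Re s) (Im s) 0).
Proof. now apply profile_sin_expdec. Qed.

Lemma F_smooth n t : ex_derive_n Fre n t /\ ex_derive_n Fim n t.
Proof.
split; apply Per_smooth; now apply profile_trig_decn.
Qed.

Lemma F_periodic : periodic Fre /\ periodic Fim.
Proof. split; now apply Per_periodic. Qed.

(** The derivative is again a periodization, hence continuous, periodic and bounded. The constant
    measures the error of the Riemann sums for the average. *)
Lemma F_lipschitz : exists K, forall u v,
  Rabs (Fre u - Fre v) <= K * Rabs (u - v) /\ Rabs (Fim u - Fim v) <= K * Rabs (u - v).
Proof.
assert (Q : forall f, decn 1 f -> exists K, forall u v, Rabs (Per f u - Per f v) <= K * Rabs (u - v)).
{ intros f [Hf [g [Hd Hg]]]; simpl in Hg.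
  destruct (periodic_bounded (Per g) (Per_periodic g Hg) (Per_cont g Hg)) as [K HK].
  exists K; intros u v.
  destruct (MVT_gen (Per f) v u (Per g)) as [c [_ E]].
  - intros; now apply Per_derive.
  - intros x _; apply continuity_pt_filterlim, Per_cont, Hf.
  - rewrite E, Rabs_mult; apply Rmult_le_compat_r; [apply Rabs_pos|apply HK]. }
destruct (Q _ (proj1 (profile_trig_decn b A (Re s) Hb HAnd HAb Hmax Hs (Im s) 1 0))) as [K1 H1].
destruct (Q _ (proj2 (profile_trig_decn b A (Re s) Hb HAnd HAb Hmax Hs (Im s) 1 0))) as [K2 H2].
exists (Rmax K1 K2); intros u v; split.
- eapply Rle_trans; [exact (H1 u v)|apply Rmult_le_compat_r; [apply Rabs_pos|apply Rmax_l]].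
- eapply Rle_trans; [exact (H2 u v)|apply Rmult_le_compat_r; [apply Rabs_pos|apply Rmax_r]].
Qed.

Let wave (k : Z) (t : R) : C :=
  let w := (s - RtoC (2 * PI * IZR k / ln (INR b)) * Ci)%C in
  (RtoC (/ ln (INR b)) * cis (2 * PI * IZR k * t) * CGamma w * sumB b A w)%C.

Let Xc t n := RInt (fun u => Fre u * cos (2 * PI * INR n * (u - t))) 0 1.
Let Yc t n := RInt (fun u => Fre u * sin (2 * PI * INR n * (u - t))) 0 1.
Let Xs t n := RInt (fun u => Fim u * cos (2 * PI * INR n * (u - t))) 0 1.
Let Ys t n := RInt (fun u => Fim u * sin (2 * PI * INR n * (u - t))) 0 1.

(** [sg] is the sign of k and n its modulus: opposite frequencies share their real Fourier
    integrals, up to the sign of the sines. *)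
Lemma wave_coef (sg : R) (k : Z) n t : IZR k = sg * INR n -> sg * sg = 1 ->
  wave k t = (Xc t n + sg * Ys t n, Xs t n - sg * Yc t n).
Proof.
intros Hk Hsg; unfold wave.
assert (E := fourier_term b A s Hb HAnd HAb Hmax Hs (2 * PI * IZR k) t); cbv zeta in E.
cbv zeta; rewrite E; clear E.
set (p := fun u => cos (2 * PI * INR n * (u - t))).
set (q := fun u => sin (2 * PI * INR n * (u - t))).
unfold Xc, Yc, Xs, Ys, Fre, Fim.
rewrite !(RInt_Per_mult _ p), !(RInt_Per_mult _ q) by (apply periodic_cos || apply periodic_sin).
assert (Hsg1 : sg = 1 \/ sg = -1) by (destruct (Rle_dec sg 0); [right|left]; nra).
assert (Cp : forall u, cos (sg * (2 * PI * INR n * (u - t))) = p u).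
{ intros u; unfold p; destruct Hsg1 as [-> | ->]; [now rewrite Rmult_1_l|].
  rewrite <- cos_neg; f_equal; ring. }
assert (Cq : forall u, sin (sg * (2 * PI * INR n * (u - t))) = sg * q u).
{ intros u; unfold q; destruct Hsg1 as [-> | ->]; [now rewrite !Rmult_1_l|].
  replace (-1 * (2 * PI * INR n * (u - t))) with (- (2 * PI * INR n * (u - t))) by ring.
  rewrite sin_neg; ring. }
assert (Bp : forall f, expdec f -> expdec (fun u => f u * p u)).
{ intros f Hf; apply expdec_mult with 1; [exact Hf|apply cont_cos_fourier|intros; apply Rabs_cos_le]. }
assert (Bq : forall f, expdec f -> expdec (fun u => f u * q u)).
{ intros f Hf; apply expdec_mult with 1; [exact Hf|apply cont_sin_fourier|intros; apply Rabs_sin_le]. }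
assert (Arg : forall u, (ln (INR b) * Im s - 2 * PI * IZR k) * u + 2 * PI * IZR k * t =
   ln (INR b) * Im s * u - sg * (2 * PI * INR n * (u - t))) by (intros; rewrite Hk; ring).
f_equal.
- rewrite <- RIntR_scal, <- RIntR_plus by auto using expdec_scal.
  apply RIntR_ext; intros u; rewrite Arg, cos_minus, Cp, Cq; unfold profile_cos, profile_sin; ring.
- assert (Q : forall x y, x - sg * y = x + - sg * y) by (intros; ring).
  rewrite Q, <- RIntR_scal, <- RIntR_plus by auto using expdec_scal.
  apply RIntR_ext; intros u; rewrite Arg, sin_minus, Cp, Cq; unfold profile_cos, profile_sin; ring.
Qed.

Lemma F_fourier t : is_zsum (fun k => wave k t) (Fre t, Fim t).
Proof.
assert (Hdc : exists f', forall u, is_derive Fre u (f' u)).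
{ destruct (proj1 (profile_trig_decn b A (Re s) Hb HAnd HAb Hmax Hs (Im s) 1 0)) as [_ [g [Hd Hg]]].
  exists (Per g); intros u; now apply Per_derive. }
assert (Hds : exists f', forall u, is_derive Fim u (f' u)).
{ destruct (proj2 (profile_trig_decn b A (Re s) Hb HAnd HAb Hmax Hs (Im s) 1 0)) as [_ [g [Hd Hg]]].
  exists (Per g); intros u; now apply Per_derive. }
destruct Hdc as [fc Hdc]; destruct Hds as [fs Hds].
destruct (fourier_pointwise Fre fc t (proj1 F_periodic) Hdc) as [xc [yc [C1 [C2 C3]]]].
destruct (fourier_pointwise Fim fs t (proj2 F_periodic) Hds) as [xs [ys [S1 [S2 S3]]]].
change (is_series (Xc t) (Fre t - xc)) in C1; change (is_series (fun k => Xc t (S k)) xc) in C2.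
change (is_series (fun k => Yc t (S k)) yc) in C3.
change (is_series (Xs t) (Fim t - xs)) in S1; change (is_series (fun k => Xs t (S k)) xs) in S2.
change (is_series (fun k => Ys t (S k)) ys) in S3.
(* The sine vanishes at frequency 0, so the conjugate series may equally start at 0, in step with
   the cosine series of the half k >= 0. *)
assert (Zero : forall f : R -> R, RInt (fun u => f u * sin (2 * PI * INR 0 * (u - t))) 0 1 = 0).
{ intros f; transitivity (RInt (fun _ : R => 0) 0 1).
  - apply RInt_ext; intros u _; simpl INR; replace (2 * PI * 0 * (u - t)) with 0 by ring.
    rewrite sin_0; rring.
  - rewrite RInt_const; unfold scal; simpl; unfold mult; simpl; ring. }
assert (C4 : is_series (Yc t) yc).
{ apply (is_series_decr_1 (V := R_NormedModule)); evar_last; [exact C3|].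
  unfold Yc; rewrite Zero; exact (eq_sym (Rminus_0_r yc)). }
assert (S4 : is_series (Ys t) ys).
{ apply (is_series_decr_1 (V := R_NormedModule)); evar_last; [exact S3|].
  unfold Ys; rewrite Zero; exact (eq_sym (Rminus_0_r ys)). }
(* The conjugate sums enter the two halves with opposite signs and cancel in the total. *)
exists (Fre t - xc + ys, Fim t - xs - yc), (xc - ys, xs + yc); split; [|split].
- assert (E : forall n, wave (Z.of_nat n) t = (Xc t n + 1 * Ys t n, Xs t n - 1 * Yc t n)).
  { intros n; apply wave_coef; [rewrite INR_IZR_INZ; ring|ring]. }
  apply is_series_C.
  + eapply is_series_ext; [|exact (is_series_plus (V := R_NormedModule) _ _ _ _ C1 S4)].
    intros n; rewrite E; simpl; unfold plus; simpl; rring.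
  + eapply is_series_ext; [|exact (is_series_minus (V := R_NormedModule) _ _ _ _ S1 C4)].
    intros n; rewrite E; simpl; unfold minus, plus, opp; simpl; rring.
- assert (E : forall n, wave (- Z.of_nat (S n)) t =
     (Xc t (S n) + -1 * Ys t (S n), Xs t (S n) - -1 * Yc t (S n))).
  { intros n; apply wave_coef; [rewrite opp_IZR, INR_IZR_INZ; ring|ring]. }
  apply is_series_C.
  + eapply is_series_ext; [|exact (is_series_minus (V := R_NormedModule) _ _ _ _ C2 S3)].
    intros n; rewrite E; simpl Re; unfold minus, plus, opp; simpl; rring.
  + eapply is_series_ext; [|exact (is_series_plus (V := R_NormedModule) _ _ _ _ S2 C3)].
    intros n; rewrite E; simpl Im; unfold plus; simpl; rring.
- apply C_eq; simpl; ring.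
Qed.

(** The wave of frequency 0, evaluated at t = 0. *)
Lemma F_mean : (RtoC (/ ln (INR b)) * CGamma s * sumB b A s)%C = (RInt Fre 0 1, RInt Fim 0 1).
Proof.
assert (E := wave_coef 1 0 0 0); simpl in E.
specialize (E ltac:(ring) ltac:(ring)).
unfold wave in E; cbv zeta in E.
replace (s - RtoC (2 * PI * 0 / ln (INR b)) * Ci)%C with s in E.
2: { apply C_eq; simpl; change (fst s) with (Re s); change (snd s) with (Im s); field; exact (Rgt_not_eq _ _ Lpos). }
replace (cis (2 * PI * 0 * 0)) with (RtoC 1) in E.
2: { unfold cis; rewrite !Rmult_0_r, cos_0, sin_0; reflexivity. }
rewrite Cmult_1_r in E; rewrite E.
assert (Q1 : forall f : R -> R, RInt (fun u => f u * cos (2 * PI * INR 0 * (u - 0))) 0 1 = RInt f 0 1).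
{ intros f; apply RInt_ext; intros u _; simpl INR; replace (2 * PI * 0 * (u - 0)) with 0 by ring.
  rewrite cos_0; rring. }
assert (Q2 : forall f : R -> R, RInt (fun u => f u * sin (2 * PI * INR 0 * (u - 0))) 0 1 = 0).
{ intros f; transitivity (RInt (fun _ : R => 0) 0 1).
  - apply RInt_ext; intros u _; simpl INR; replace (2 * PI * 0 * (u - 0)) with 0 by ring.
    rewrite sin_0; rring.
  - rewrite RInt_const; unfold scal; simpl; unfold mult; simpl; ring. }
unfold Xc, Yc, Xs, Ys; rewrite !Q1, !Q2; apply C_eq; unfold Re, Im, fst, snd; rring.
Qed.

End Main.

(** * Moments *)

Lemma bernoulli_exp m z : 1 <= m -> 0 <= z < 1 -> 1 - m * z <= exp (m * ln (1 - z)).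
Proof.
intros Hm Hz.
destruct (MVT_gen (fun z => exp (m * ln (1 - z))) 0 z (fun c => - (m * / (1 - c) * exp (m * ln (1 - c)))))
  as [c [Hc E]].
- intros c; rewrite Rmin_left, Rmax_right by lra; intros Hc; auto_derive; [lra|].
  unfold Rminus; field; lra.
- intros c; rewrite Rmin_left, Rmax_right by lra; intros Hc.
  apply continuity_pt_filterlim, (ex_derive_continuous (fun z => exp (m * ln (1 - z)))); auto_derive; lra.
- rewrite Rmin_left, Rmax_right in Hc by lra.
  rewrite !Rminus_0_r, ln_1, Rmult_0_r, exp_0 in E.
  assert (Hl : ln (1 - c) <= 0).
  { rewrite <- ln_1; destruct (Req_dec c 0) as [->|Hc0]; [rewrite Rminus_0_r; lra|].
    left; apply ln_increasing; lra. }
  (* This is (1 - c)^(m - 1), so the derivative given by the mean value theorem is at least -m. *)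
  assert (Hx : / (1 - c) * exp (m * ln (1 - c)) <= 1).
  { rewrite <- (exp_ln (1 - c)) at 1 by lra; rewrite <- exp_Ropp, <- exp_plus.
    apply Rle_trans with (exp 0); [apply exp_le_compat; nra|rewrite exp_0; lra]. }
  assert (Hp : 0 < exp (m * ln (1 - c))) by apply exp_pos.
  set (B := / (1 - c) * exp (m * ln (1 - c))) in *.
  replace (- (m * / (1 - c) * exp (m * ln (1 - c)))) with (- (m * B)) in E by (unfold B; ring).
  assert (m * B * z <= m * z); [|nra].
  apply Rmult_le_compat_r; [lra|]; rewrite <- (Rmult_1_r m) at 2; apply Rmult_le_compat_l; lra.
Qed.

(** At y = (n + 1) / b^l the test y <= 1 means n < b^l; extension by 0 turns the finite sum of a
    level into a series over all n. *)
Definition trunc_pow (y m : R) : R := if Rle_dec y 1 then rpow0 (1 - y) m else 0.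

(* From (1 - y) e^y >= 1 - y^2 and Bernoulli's inequality. *)
Lemma trunc_pow_bounds m y : 1 <= m -> 0 < y ->
  0 <= trunc_pow y m <= exp (- (m * y)) /\
  exp (- (m * y)) - trunc_pow y m <= m * y ^ 2 * exp (- (m * y)).
Proof.
intros Hm Hy; assert (He := exp_pos (- (m * y))).
(* For y >= 1 the power is 0 and the error bound holds because m y^2 >= 1. *)
assert (Big : 1 <= y -> 0 <= 0 <= exp (- (m * y)) /\
  exp (- (m * y)) - 0 <= m * y ^ 2 * exp (- (m * y))).
{ intros H1; split; [lra|]. assert (1 <= m * y ^ 2) by (simpl; nra). nra. }
unfold trunc_pow; destruct (Rle_dec y 1) as [H|H]; [|apply Big; lra].
unfold rpow0; destruct (Req_EM_T (1 - y) 0) as [H0|H0].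
- destruct (Req_EM_T m 0) as [Hm0|_]; [lra|]; apply Big; lra.
- unfold Rpower.
  assert (Hy1 : y < 1) by lra.
  assert (L1 : ln (1 - y) <= - y).
  { rewrite <- (ln_exp (- y)); assert (Q := exp_ineq1_le (- y)).
    destruct Q as [Q|Q]; [left; apply ln_increasing; lra|right; f_equal; lra]. }
  split; [split; [left; apply exp_pos|apply exp_le_compat; nra]|].
  assert (L2 : ln (1 - y ^ 2) <= ln (1 - y) + y).
  { replace (1 - y ^ 2) with ((1 - y) * (1 + y)) by ring.
    rewrite ln_mult by lra; apply Rplus_le_compat_l.
    rewrite <- (ln_exp y) at 2; assert (Q := exp_ineq1_le y).
    destruct Q as [Q|Q]; [left; apply ln_increasing; lra|right; f_equal; lra]. }
  assert (B := bernoulli_exp m (y ^ 2) Hm ltac:(simpl; nra)).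
  assert (E1 : exp (m * ln (1 - y ^ 2)) <= exp (m * (ln (1 - y) + y)))
    by (apply exp_le_compat; nra).
  (* The first factor is ((1 - y) e^y)^m >= (1 - y^2)^m >= 1 - m y^2. *)
  assert (E2 : exp (m * ln (1 - y)) = exp (m * (ln (1 - y) + y)) * exp (- (m * y)))
    by (rewrite <- exp_plus; f_equal; ring).
  rewrite E2; nra.
Qed.

Lemma Series_finite f M : (forall n, (M <= n)%nat -> f n = 0) -> Series f = nsum f M.
Proof.
intros H; apply is_series_unique, is_series_eps; intros eps He.
exists M; intros n Hn; rewrite <- nsum_psum.
replace (S n) with (M + (S n - M))%nat by lia; rewrite nsum_split.
rewrite (nsum_ext (fun k => f (M + k)%nat) (fun _ => 0 * 0)) by (intros; rewrite H by lia; ring).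
rewrite nsum_scal, Rmult_0_l, Rplus_0_r, Rminus_diag, Rabs_R0; exact He.
Qed.

Lemma csum_scal {T : Type} (f : T -> R) (c : C) l :
  csum (map (fun w => (RtoC (f w) * c)%C) l) = (RtoC (lsum (map f l)) * c)%C.
Proof.
induction l as [|x l IH]; [apply C_eq; simpl; unfold lsum; simpl; ring|].
change (RtoC (f x) * c + csum (map (fun w => (RtoC (f w) * c)%C) l) = RtoC (f x + lsum (map f l)) * c)%C.
rewrite IH, RtoC_plus; ring.
Qed.

(** * The second expression and the asymptotics of the moments *)

Section Second.

Variables (b : nat) (A : list nat) (s : C).
Hypotheses (Hb : (2 <= b)%nat) (HAnd : NoDup A)
  (HAb : List.Forall (fun a => (a < b)%nat) A) (Hmax : fmax A = (b - 1)%nat)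
  (Hs : ln (INR (length A)) / ln (INR b) < Re s).

Let L := ln (INR b).
Let Lpos : 0 < L := ln_b_pos b Hb.
Let bpos : 0 < INR b := b_pos b Hb.

Lemma cpow_shift m (y : R) : 0 < m ->
  (cpow m s * cpow (INR b) (RtoC y * s))%C =
  (exp (L * Re s * (ln m / L + y)) * cos (L * Im s * (ln m / L + y)),
   exp (L * Re s * (ln m / L + y)) * sin (L * Im s * (ln m / L + y))).
Proof.
intros Hm; rewrite !cpow_pos by assumption; fold L.
assert (R1 : Re (RtoC y * s) = y * Re s) by (unfold Re, Im; simpl; ring).
assert (I1 : Im (RtoC y * s) = y * Im s) by (unfold Re, Im; simpl; ring).
rewrite R1, I1.
replace (L * Re s * (ln m / L + y)) with (Re s * ln m + y * Re s * L) by (field; lra).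
replace (L * Im s * (ln m / L + y)) with (Im s * ln m + y * Im s * L) by (field; lra).
rewrite exp_plus, cos_plus, sin_plus; apply C_eq; simpl; ring.
Qed.

Lemma cpow_opp m : 0 < m -> (cpow m s * cpow m (- s))%C = RtoC 1.
Proof.
intros Hm; rewrite !cpow_pos by assumption.
assert (R1 : Re (- s) = - Re s) by reflexivity.
assert (I1 : Im (- s) = - Im s) by reflexivity.
rewrite R1, I1, <- !Ropp_mult_distr_l, cos_neg, sin_neg, exp_Ropp.
assert (Q := sin2_cos2 (Im s * ln m)); unfold Rsqr in Q.
assert (P := exp_pos (Re s * ln m)).
apply C_eq; simpl; [|field; lra].
rewrite <- Q; field; lra.
Qed.

Lemma profile_0 t :
  profile b A (Re s) 0 t =
  exp (L * Re s * t) * (exp (- exp (L * t)) * Series (fun n => indB b A n * exp (- (INR n * exp (L * t))))).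
Proof.
unfold profile; rewrite <- !Series_scal_l; apply Series_ext; intros n; unfold term; fold L.
simpl pow; simpl INR.
replace (L * (Re s + 0) * t - (INR n + 1) * exp (L * t)) with
  (L * Re s * t + (- exp (L * t) + - (INR n * exp (L * t)))) by ring.
rewrite !exp_plus; ring.
Qed.

(** With t = log_b m one has b^j m = b^(t + j), so the j-th term is m^(-s) Phi(t + j) and the two
    halves are those of the periodization. *)
Lemma F_second m : 0 < m ->
  exists S : C,
    is_zsum (fun j : Z =>
      (cpow (INR b) (RtoC (IZR j) * s)
       * RtoC (exp (- (powerRZ (INR b) j * m)))
       * RtoC (Series (fun n : nat =>
            (indB b A n * exp (- (INR n * powerRZ (INR b) j * m)))%R)))%C) S
    /\ (Fre b A s (ln m / L), Fim b A s (ln m / L)) = (cpow m s * S)%C.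
Proof.
intros Hm; set (t := ln m / L).
assert (E : forall j : Z,
  (cpow (INR b) (RtoC (IZR j) * s)
       * RtoC (exp (- (powerRZ (INR b) j * m)))
       * RtoC (Series (fun n : nat =>
            (indB b A n * exp (- (INR n * powerRZ (INR b) j * m)))%R)))%C =
  (cpow m (- s) * (profile_cos b A (Re s) (Im s) 0 (t + IZR j), profile_sin b A (Re s) (Im s) 0 (t + IZR j)))%C).
{ intros j.
  assert (X : powerRZ (INR b) j * m = exp (L * (t + IZR j))).
  { rewrite powerRZ_Rpower by exact bpos; unfold Rpower; fold L.
    rewrite <- (exp_ln m) at 1 by exact Hm; rewrite <- exp_plus; f_equal; unfold t; field; lra. }
  assert (P : (profile_cos b A (Re s) (Im s) 0 (t + IZR j), profile_sin b A (Re s) (Im s) 0 (t + IZR j)) =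
    (cpow m s * cpow (INR b) (RtoC (IZR j) * s) *
     RtoC (exp (- exp (L * (t + IZR j))) * Series (fun n => indB b A n * exp (- (INR n * exp (L * (t + IZR j))))))%R)%C).
  { rewrite cpow_shift by exact Hm; fold t.
    unfold profile_cos, profile_sin; rewrite profile_0; fold L.
    apply C_eq; simpl; ring. }
  rewrite P, X, (Series_ext _ (fun n => indB b A n * exp (- (INR n * exp (L * (t + IZR j)))))).
  2: { intros n; rewrite Rmult_assoc, X; reflexivity. }
  rewrite RtoC_mult.
  replace (cpow (INR b) (RtoC (IZR j) * s)) with (cpow m s * cpow m (- s) * cpow (INR b) (RtoC (IZR j) * s))%C at 1
    by (rewrite cpow_opp by exact Hm; apply Cmult_1_l).
  ring. }
assert (Dc := profile_cos_expdec b A (Re s) Hb HAnd HAb Hmax Hs (Im s) 0).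
assert (Ds := profile_sin_expdec b A (Re s) Hb HAnd HAb Hmax Hs (Im s) 0).
exists (cpow m (- s) * (Fre b A s t, Fim b A s t))%C; split.
- set (fc := profile_cos b A (Re s) (Im s) 0) in *; set (fs := profile_sin b A (Re s) (Im s) 0) in *.
  exists (cpow m (- s) * (Series (fun n => fc (t + INR n)%R), Series (fun n => fs (t + INR n)%R)))%C.
  exists (cpow m (- s) * (Series (fun n => fc (t - INR (S n))%R), Series (fun n => fs (t - INR (S n))%R)))%C.
  split; [|split].
  + eapply is_series_ext; [intros n; symmetry; apply E|].
    apply (is_series_scal (K := C_AbsRing) (V := C_NormedModule) (cpow m (- s))).
    apply is_series_C; simpl.
    * eapply is_series_ext; [|apply Series_correct, (locdom_ex _ t (locdom_up fc Dc))].
      intros n; simpl; now rewrite <- INR_IZR_INZ.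
    * eapply is_series_ext; [|apply Series_correct, (locdom_ex _ t (locdom_up fs Ds))].
      intros n; simpl; now rewrite <- INR_IZR_INZ.
  + eapply is_series_ext; [intros n; symmetry; apply E|].
    apply (is_series_scal (K := C_AbsRing) (V := C_NormedModule) (cpow m (- s))).
    apply is_series_C.
    * eapply is_series_ext; [|apply Series_correct, (locdom_ex _ t (locdom_dn fc Dc))].
      intros n; cbv beta; rewrite opp_IZR, <- INR_IZR_INZ; reflexivity.
    * eapply is_series_ext; [|apply Series_correct, (locdom_ex _ t (locdom_dn fs Ds))].
      intros n; cbv beta; rewrite opp_IZR, <- INR_IZR_INZ; reflexivity.
  + rewrite <- Cmult_plus_distr_l; reflexivity.
- rewrite Cmult_assoc, cpow_opp by exact Hm; now rewrite Cmult_1_l.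
Qed.

(** By [words_sum], the sum of x_w^m over words of length l. [rpow0] matters at n = b^l - 1, where
    the base is 0. *)
Definition level (l : nat) (m : R) : R :=
  nsum (fun n => indB b A n * rpow0 (1 - (INR n + 1) / INR b ^ l) m) (b ^ l).

(** With y = (n + 1) / b^l one has m y = (n + 1) b^t. The bounds of [trunc_pow_bounds] thus become,
    term by term, the profiles of index 0 and 2. *)
Lemma level_profile l m : 1 <= m ->
  let t := ln m / L - INR l in
  0 <= exp (L * Re s * t) * level l m <= profile b A (Re s) 0 t /\
  profile b A (Re s) 0 t - exp (L * Re s * t) * level l m <= / m * profile b A (Re s) 2 t.
Proof.
intros Hm t.
assert (Hbl : 0 < INR b ^ l) by (now apply pow_lt).
set (y := fun n => (INR n + 1) / INR b ^ l).
assert (Hy : forall n, 0 < y n) by (intros n; apply Rdiv_lt_0_compat; [apply INR1_pos|exact Hbl]).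
assert (Ey : forall n, m * y n = (INR n + 1) * exp (L * t)).
{ intros n; unfold t, y.
  replace (L * (ln m / L - INR l)) with (ln m - L * INR l) by (field; lra).
  unfold Rminus; rewrite exp_plus, exp_Ropp, exp_ln, exp_INR by lra; unfold L; rewrite exp_ln by exact bpos.
  field; lra. }
set (v := fun n => exp (L * Re s * t) * (indB b A n * trunc_pow (y n) m)).
assert (Ev : exp (L * Re s * t) * level l m = Series v).
{ unfold v; rewrite Series_scal_l; f_equal; unfold level.
  rewrite (Series_finite _ (b ^ l)).
  - apply nsum_ext; intros n Hn; f_equal; unfold trunc_pow, y.
    destruct (Rle_dec ((INR n + 1) / INR b ^ l) 1) as [_|H]; [reflexivity|exfalso; apply H].
    apply Rmult_le_reg_r with (INR b ^ l); [exact Hbl|].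
    unfold Rdiv; rewrite Rmult_assoc, Rinv_l, Rmult_1_r, Rmult_1_l by lra.
    rewrite <- pow_INR, <- S_INR; now apply le_INR.
  - intros n Hn; unfold trunc_pow, y.
    destruct (Rle_dec ((INR n + 1) / INR b ^ l) 1) as [H|_]; [exfalso|ring].
    apply Rmult_le_compat_r with (r := INR b ^ l) in H; [|lra].
    unfold Rdiv in H; rewrite Rmult_assoc, Rinv_l, Rmult_1_r, Rmult_1_l in H by lra.
    rewrite <- pow_INR, <- S_INR in H; apply INR_le in H; lia. }
assert (T0 : forall n, term b A (Re s) 0 n t = exp (L * Re s * t) * (indB b A n * exp (- (m * y n)))).
{ intros n; unfold term; fold L; rewrite Ey; simpl pow; simpl INR.
  replace (L * (Re s + 0) * t - (INR n + 1) * exp (L * t)) with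
    (L * Re s * t + - ((INR n + 1) * exp (L * t))) by ring.
  rewrite exp_plus; ring. }
assert (T2 : forall n, term b A (Re s) 2 n t =
   exp (L * Re s * t) * (indB b A n * ((m * y n) ^ 2 * exp (- (m * y n))))).
{ intros n; unfold term; fold L; rewrite Ey; simpl pow; simpl INR.
  replace (L * (Re s + (1 + 1)) * t - (INR n + 1) * exp (L * t)) with
    (L * t + L * t + (L * Re s * t + - ((INR n + 1) * exp (L * t)))) by ring.
  rewrite !exp_plus; ring. }
assert (Hex := exp_pos (L * Re s * t)).
assert (V0 : forall n, 0 <= v n <= term b A (Re s) 0 n t).
{ intros n; rewrite T0; unfold v.
  destruct (trunc_pow_bounds m (y n) Hm (Hy n)) as [[B1 B2] _]; destruct (indB_bounds b A n) as [B3 _].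
  split.
  - repeat apply Rmult_le_pos; lra.
  - repeat (apply Rmult_le_compat_l; [lra|]); exact B2. }
assert (V2 : forall n, term b A (Re s) 0 n t - v n <= / m * term b A (Re s) 2 n t).
{ intros n; rewrite T0, T2; unfold v.
  destruct (trunc_pow_bounds m (y n) Hm (Hy n)) as [_ B]; destruct (indB_bounds b A n) as [B3 _].
  rewrite <- !Rmult_minus_distr_l.
  replace (/ m * (exp (L * Re s * t) * (indB b A n * ((m * y n) ^ 2 * exp (- (m * y n)))))) with
    (exp (L * Re s * t) * (indB b A n * (m * y n ^ 2 * exp (- (m * y n))))) by (field; lra).
  repeat (apply Rmult_le_compat_l; [lra|]); exact B. }
assert (X0 := ex_series_term b A (Re s) Hb HAnd HAb Hmax Hs 0 t).
assert (X2 := ex_series_term b A (Re s) Hb HAnd HAb Hmax Hs 2 t).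
assert (Xv : ex_series v).
{ apply ex_series_dom with (2 := X0); intros n; rewrite Rabs_pos_eq; apply V0. }
rewrite Ev; unfold profile; split; [split|].
- apply Series_nonneg; [apply V0|exact Xv].
- now apply Series_le.
- rewrite <- Series_minus, <- Series_scal_l by assumption.
  apply Series_le.
  + intros n; split; [generalize (V0 n); lra|apply V2].
  + now apply (ex_series_scal (V := R_NormedModule)).
Qed.

(** At these arguments b^t >= m, so ((n + 1) b^t)^2 >= m^2 >= m and the whole term of index 0 is
    already of the size of the error. *)
Lemma profile_far n m : 1 <= m ->
  profile b A (Re s) 0 (ln m / L + INR n) <= / m * profile b A (Re s) 2 (ln m / L + INR n).
Proof.
intros Hm; set (t := ln m / L + INR n).
unfold profile; rewrite <- Series_scal_l; apply Series_le.
2: { apply (ex_series_scal (V := R_NormedModule)); now apply ex_series_term. }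
intros k; split; [apply term_nonneg|].
unfold term; fold L; simpl pow; simpl INR.
replace (L * (Re s + (1 + 1)) * t - (INR k + 1) * exp (L * t)) with
  (L * t + L * t + (L * (Re s + 0) * t - (INR k + 1) * exp (L * t))) by ring.
rewrite !exp_plus.
set (e := exp (L * (Re s + 0) * t - (INR k + 1) * exp (L * t))).
assert (He : 0 < e) by apply exp_pos.
assert (Hx : m <= exp (L * t)).
{ rewrite <- (exp_ln m) at 1 by lra; apply exp_le_compat; unfold t.
  replace (L * (ln m / L + INR n)) with (ln m + L * INR n) by (field; lra).
  assert (0 <= L * INR n) by (apply Rmult_le_pos; [lra|apply pos_INR]); lra. }
set (x := exp (L * t)) in *.
destruct (indB_bounds b A k) as [Hi _].
assert (Hk := pos_INR k).
replace (/ m * (indB b A k * ((INR k + 1) * ((INR k + 1) * 1) * (x * x * e)))) with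
  (indB b A k * (/ m * ((INR k + 1) * (INR k + 1) * (x * x)) * e)) by ring.
apply Rmult_le_compat_l; [exact Hi|]; apply Rmult_le_compat_r; [lra|].
apply Rmult_le_reg_l with m; [lra|]; rewrite <- Rmult_assoc, Rinv_r, Rmult_1_r, Rmult_1_l by lra.
assert (m * m <= x * x) by nra.
assert (1 <= (INR k + 1) * (INR k + 1)) by nra.
nra.
Qed.

(** The upward half of the periodization has no counterpart among the levels l >= 1 and is pure
    error; the downward half is compared level by level. [p] will be the cosine or sine of L (Im s)
    t. *)
Lemma level_sum m p : 1 <= m -> (forall t, Rabs (p t) <= 1) ->
  Rabs (Series (fun l => exp (L * Re s * (ln m / L - INR (S l))) * level (S l) m * p (ln m / L - INR (S l))) -
        Per (fun t => profile b A (Re s) 0 t * p t) (ln m / L))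
  <= / m * Per (profile b A (Re s) 2) (ln m / L).
Proof.
intros Hm Hp; set (t := ln m / L).
assert (D0 := profile_expdec b A (Re s) Hb HAnd HAb Hmax Hs 0).
assert (D2 := profile_expdec b A (Re s) Hb HAnd HAb Hmax Hs 2).
assert (Xu := locdom_ex _ t (locdom_up _ D2)); assert (Xd := locdom_ex _ t (locdom_dn _ D2)).
assert (Yd := locdom_ex _ t (locdom_dn _ D0)).
cbv beta in Xu, Xd, Yd.
assert (Hm0 : 0 < / m) by (apply Rinv_0_lt_compat; lra).
assert (Mp : forall a x, 0 <= a -> Rabs (a * p x) <= a).
{ intros a x Ha; rewrite Rabs_mult, Rabs_pos_eq by exact Ha.
  rewrite <- (Rmult_1_r a) at 2; apply Rmult_le_compat_l; [exact Ha|apply Hp]. }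
assert (E1 : ex_series (fun l => exp (L * Re s * (t - INR (S l))) * level (S l) m * p (t - INR (S l)))).
{ apply ex_series_dom with (2 := Yd); intros l.
  destruct (level_profile (S l) m Hm) as [[B1 B2] _].
  eapply Rle_trans; [apply Mp, B1|exact B2]. }
assert (E2 : ex_series (fun l => profile b A (Re s) 0 (t - INR (S l)) * p (t - INR (S l)))).
{ apply ex_series_dom with (2 := Yd); intros l; apply Mp; now apply profile_nonneg. }
unfold Per.
set (U := Series (fun n => profile b A (Re s) 0 (t + INR n) * p (t + INR n))).
assert (BU : Rabs U <= / m * Series (fun n => profile b A (Re s) 2 (t + INR n))).
{ unfold U; rewrite <- Series_scal_l; apply Series_abs_le.
  - intros n; eapply Rle_trans; [apply Mp; now apply profile_nonneg|now apply profile_far].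
  - now apply (ex_series_scal (V := R_NormedModule)). }
match goal with |- Rabs (Series ?a - (U + Series ?c)) <= _ => set (V := Series a); set (W := Series c) end.
assert (BV : Rabs (V - W) <= / m * Series (fun n => profile b A (Re s) 2 (t - INR (S n)))).
{ unfold V, W; rewrite <- Series_minus, <- Series_scal_l by assumption; apply Series_abs_le.
  - intros l; rewrite <- Rmult_minus_distr_r.
    destruct (level_profile (S l) m Hm) as [[B1 B2] B3]; fold t in B1, B2, B3.
    rewrite <- Rabs_Ropp, Ropp_mult_distr_l, Ropp_minus_distr.
    eapply Rle_trans; [apply Mp; lra|exact B3].
  - now apply (ex_series_scal (V := R_NormedModule)). }
replace (V - (U + W)) with ((V - W) + - U) by ring.
rewrite Rmult_plus_distr_l; eapply Rle_trans; [apply Rabs_triang|]; rewrite Rabs_Ropp; lra.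
Qed.

Lemma umom_level m : 1 <= m ->
  (cpow m s * umom b A s m)%C =
  (Series (fun l => exp (L * Re s * (ln m / L - INR (S l))) * level (S l) m * cos (L * Im s * (ln m / L - INR (S l)))),
   Series (fun l => exp (L * Re s * (ln m / L - INR (S l))) * level (S l) m * sin (L * Im s * (ln m / L - INR (S l))))).
Proof.
intros Hm; unfold umom.
assert (Hm0 : 0 < m) by lra.
set (c := fun l : nat => cpow (INR b) (- (RtoC (INR (S l)) * s))).
assert (Ec : forall l, (cpow m s * c l)%C =
  (exp (L * Re s * (ln m / L - INR (S l))) * cos (L * Im s * (ln m / L - INR (S l))),
   exp (L * Re s * (ln m / L - INR (S l))) * sin (L * Im s * (ln m / L - INR (S l))))).
{ intros l; unfold c; unfold Rminus; rewrite <- cpow_shift by exact Hm0; do 2 f_equal.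
  rewrite RtoC_opp; ring. }
(* The unit mass at 0, which is level l = 0, contributes 0^m = 0 because m >= 1. *)
replace (RtoC (rpow0 0 m)) with (RtoC 0).
2: { unfold rpow0; destruct (Req_EM_T 0 0); [|easy]; destruct (Req_EM_T m 0); [lra|reflexivity]. }
rewrite Cplus_0_l.
set (a := fun l => csum _).
assert (Ea : forall l, a l = (RtoC (level (S l) m) * c l)%C).
{ intros l; unfold a; rewrite csum_scal; fold (c l); do 2 f_equal.
  now rewrite (words_sum b A Hb HAnd HAb Hmax (S l) (fun x => rpow0 x m)). }
set (t := ln m / L) in *.
set (k := cpow m s) in *.
set (k' := cpow m (- s)).
assert (Kk : (k * k')%C = RtoC 1) by (now apply cpow_opp).
set (gc := fun l => exp (L * Re s * (t - INR (S l))) * level (S l) m * cos (L * Im s * (t - INR (S l)))).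
set (gs := fun l => exp (L * Re s * (t - INR (S l))) * level (S l) m * sin (L * Im s * (t - INR (S l)))).
(* Written with m^(-s) in front, the componentwise series [CSeries] is a linear combination of two
   real series, convergent by comparison with the profile. *)
assert (Eg : forall l, a l = (k' * (gc l, gs l))%C).
{ intros l; rewrite Ea.
  replace ((gc l, gs l) : C) with (RtoC (level (S l) m) * (k * c l))%C
    by (rewrite Ec; unfold gc, gs; apply C_eq; simpl; ring).
  replace (c l) with (k * k' * c l)%C at 1 by (rewrite Kk; apply Cmult_1_l); ring. }
assert (Yd := locdom_ex _ t (locdom_dn _ (profile_expdec b A (Re s) Hb HAnd HAb Hmax Hs 0))).
cbv beta in Yd.
assert (Mp : forall x y, 0 <= x -> Rabs y <= 1 -> Rabs (x * y) <= x).
{ intros x y Hx Hy; rewrite Rabs_mult, Rabs_pos_eq by exact Hx.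
  rewrite <- (Rmult_1_r x) at 2; now apply Rmult_le_compat_l. }
assert (Xc : ex_series gc).
{ apply ex_series_dom with (2 := Yd); intros l.
  destruct (level_profile (S l) m Hm) as [[B1 B2] _]; fold t in B1, B2.
  eapply Rle_trans; [apply Mp; [exact B1|apply Rabs_cos_le]|exact B2]. }
assert (Xs : ex_series gs).
{ apply ex_series_dom with (2 := Yd); intros l.
  destruct (level_profile (S l) m Hm) as [[B1 B2] _]; fold t in B1, B2.
  eapply Rle_trans; [apply Mp; [exact B1|apply Rabs_sin_le]|exact B2]. }
replace (CSeries a) with (k' * (Series gc, Series gs))%C.
- rewrite Cmult_assoc, Kk; apply Cmult_1_l.
- unfold CSeries; apply C_eq; simpl.
  + rewrite <- !Series_scal_l, <- Series_minus by (now apply (ex_series_scal (V := R_NormedModule))).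
    apply Series_ext; intros l; rewrite Eg; reflexivity.
  + rewrite <- !Series_scal_l, <- Series_plus by (now apply (ex_series_scal (V := R_NormedModule))).
    apply Series_ext; intros l; rewrite Eg; reflexivity.
Qed.

(** K is a bound for the periodization of the profile of index 2, which is continuous and
    periodic. *)
Lemma moment_asymptotics : exists K, 0 <= K /\ forall m, 1 <= m ->
  Rabs (Re (cpow m s * umom b A s m) - Fre b A s (ln m / L)) <= K / m /\
  Rabs (Im (cpow m s * umom b A s m) - Fim b A s (ln m / L)) <= K / m.
Proof.
assert (D2 := profile_expdec b A (Re s) Hb HAnd HAb Hmax Hs 2).
destruct (periodic_bounded _ (Per_periodic _ D2) (Per_cont _ D2)) as [K HK].
exists K; split; [eapply Rle_trans; [apply Rabs_pos|apply (HK 0)]|].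
intros m Hm.
assert (HB : / m * Per (profile b A (Re s) 2) (ln m / L) <= K / m).
{ unfold Rdiv at 2; rewrite Rmult_comm; apply Rmult_le_compat_r; [left; apply Rinv_0_lt_compat; lra|].
  eapply Rle_trans; [apply Rle_abs|apply HK]. }
rewrite umom_level by exact Hm; split; (eapply Rle_trans; [|exact HB]).
- apply (level_sum m (fun t => cos (L * Im s * t)) Hm); intros; apply Rabs_cos_le.
- apply (level_sum m (fun t => sin (L * Im s * t)) Hm); intros; apply Rabs_sin_le.
Qed.

End Second.

(** * The average of the integer moments *)

Lemma sum_n_m_C (f : nat -> C) a k :
  @sum_n_m C_AbelianMonoid f (a + 1) (a + k) =
  (nsum (fun i => Re (f (a + S i)%nat)) k, nsum (fun i => Im (f (a + S i)%nat)) k).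
Proof.
induction k as [|k IH].
- rewrite sum_n_m_zero by lia; reflexivity.
- rewrite (Nat.add_succ_r a k), sum_n_Sm, IH by lia; rewrite <- (Nat.add_succ_r a k); reflexivity.
Qed.

Lemma ln_ratio m : 2 <= m -> 0 <= ln (m / (m - 1)) <= / (m - 1).
Proof.
intros Hm.
assert (E : m / (m - 1) = 1 + / (m - 1)) by (field; lra).
assert (0 < / (m - 1)) by (apply Rinv_0_lt_compat; lra).
rewrite E; split.
- rewrite <- ln_1; left; apply ln_increasing; lra.
- rewrite <- (ln_exp (/ (m - 1))) at 2; assert (Q := exp_ineq1_le (/ (m - 1))).
  destruct Q as [Q|Q]; [left; apply ln_increasing; lra|right; now f_equal].
Qed.

(* A Riemann sum for [h] at the nodes log_b m; the weights log_b (m / (m - 1))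
   are the mesh lengths. *)
Lemma log_average (b : nat) (h : R -> R) (y : nat -> R) K Lip :
  (2 <= b)%nat -> cont h -> periodic h -> 0 <= K ->
  (forall u v, Rabs (h u - h v) <= Lip * Rabs (u - v)) ->
  (forall m, (1 <= m)%nat -> Rabs (y m - h (ln (INR m) / ln (INR b))) <= K / INR m) ->
  forall eps, 0 < eps -> exists N, forall p, (N <= p)%nat ->
    Rabs (nsum (fun i => y (b ^ p + S i)%nat *
       (ln (INR (b ^ p + S i) / (INR (b ^ p + S i) - 1)) / ln (INR b))) (b ^ S p - b ^ p) - RInt h 0 1) < eps.
Proof.
intros Hb Hc Hp HK HL Hy eps He.
set (L := ln (INR b)) in *; assert (Lpos : 0 < L) by exact (ln_b_pos b Hb).
assert (HLip : 0 <= Lip).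
{ assert (Q := HL 1 0); rewrite Rminus_0_r, Rabs_R1, Rmult_1_r in Q.
  eapply Rle_trans; [apply Rabs_pos|exact Q]. }
(* K pays for replacing [y m] by [h], and Lip / L for the variation of [h] over a cell, whose length
   is at most 1 / (L a). *)
set (C := K + Lip / L).
assert (HC : 0 <= C) by (unfold C; assert (0 <= Lip / L) by (now apply Rdiv_le_0_compat); lra).
set (d := fun m : nat => ln (INR m / (INR m - 1)) / L).
(* The error is C / a per unit of length in log_b m; the block from b^p to b^(p + 1) has length 1,
   so its error is C / b^p. *)
assert (Main : forall a k, (1 <= a)%nat ->
  Rabs (nsum (fun i => y (a + S i)%nat * d (a + S i)%nat) k -
     RInt h (ln (INR a) / L) (ln (INR (a + k)) / L)) <=
  C / INR a * (ln (INR (a + k)) / L - ln (INR a) / L)).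
{ intros a k Ha; assert (Ha1 : 1 <= INR a) by (change 1 with (INR 1); now apply le_INR).
  induction k as [|k IH].
  - rewrite Nat.add_0_r, RInt_point; unfold zero; simpl; rewrite !Rminus_diag, Rabs_R0; lra.
  - simpl nsum.
    set (m := (a + S k)%nat).
    assert (Em : INR (a + k) = INR m - 1) by (unfold m; rewrite Nat.add_succ_r, S_INR; ring).
    rewrite Em in IH.
    assert (Hm : INR a + 1 <= INR m) by (rewrite <- S_INR; apply le_INR; unfold m; lia).
    set (t1 := ln (INR m) / L); set (t0 := ln (INR m - 1) / L) in *.
    assert (Ed : d m = t1 - t0).
    { unfold d, t1, t0; rewrite ln_div by lra; field; lra. }
    assert (Hd : 0 <= d m <= / L / INR a).
    { destruct (ln_ratio (INR m)) as [Q1 Q2]; [lra|]; unfold d; split; [now apply Rdiv_le_0_compat|].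
      unfold Rdiv; rewrite (Rmult_comm (/ L)); apply Rmult_le_compat_r; [left; now apply Rinv_0_lt_compat|].
      eapply Rle_trans; [exact Q2|]; apply Rinv_le_contravar; lra. }
    assert (One : Rabs (y m * d m - RInt h t0 t1) <= C / INR a * d m).
    { replace (y m * d m - RInt h t0 t1) with ((y m - h t1) * d m + - (RInt h t0 t1 - h t1 * (t1 - t0)))
        by (rewrite Ed; ring).
      assert (Q : RInt h t0 t1 - h t1 * (t1 - t0) = RInt (fun u => h u - h t1) t0 t1).
      { rewrite RInt_Rminus, RInt_const by (trivial; apply cont_const).
        unfold scal; simpl; unfold mult; simpl; ring. }
      rewrite Q; eapply Rle_trans; [apply Rabs_triang|].
      replace (C / INR a * d m) with (K / INR a * d m + d m * (Lip * (/ L / INR a))) by (unfold C; field; lra).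
      apply Rplus_le_compat.
      - rewrite Rabs_mult, (Rabs_pos_eq (d m)) by lra; apply Rmult_le_compat_r; [lra|].
        eapply Rle_trans; [apply Hy; unfold m; lia|].
        unfold Rdiv; apply Rmult_le_compat_l; [exact HK|]; apply Rinv_le_contravar; lra.
      - rewrite Rabs_Ropp.
        rewrite Ed at 1; rewrite <- (Rabs_pos_eq (t1 - t0)) by lra.
        apply RInt_abs_bound.
        + apply (cont_plus h (fun _ => - h t1)); [exact Hc|apply cont_const].
        + intros u; rewrite Rmin_left, Rmax_right by lra; intros Hu.
          eapply Rle_trans; [apply HL|]; apply Rmult_le_compat_l; [exact HLip|].
          rewrite Rabs_left1; lra. }
    rewrite <- (RInt_split h _ t0 t1 Hc).
    match goal with |- Rabs (?x + ?u - (?z + ?w)) <= _ =>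
      replace (x + u - (z + w)) with ((x - z) + (u - w)) by ring end.
    eapply Rle_trans; [apply Rabs_triang|].
    replace (C / INR a * (t1 - ln (INR a) / L)) with
      (C / INR a * (t0 - ln (INR a) / L) + C / INR a * d m) by (rewrite Ed; ring).
    now apply Rplus_le_compat. }
destruct (nfloor_ex (C / eps)) as [N HN]; [now apply Rdiv_le_0_compat|].
exists (S N); intros p HNp.
assert (Hbp : (1 <= b ^ p)%nat) by (apply Nat.neq_0_lt_0, Nat.pow_nonzero; lia).
assert (Hle : (b ^ p <= b ^ S p)%nat) by (apply Nat.pow_le_mono_r; lia).
specialize (Main (b ^ p)%nat (b ^ S p - b ^ p)%nat Hbp).
replace (b ^ p + (b ^ S p - b ^ p))%nat with (b ^ S p)%nat in Main by lia.
assert (Hlog : forall k, ln (INR (b ^ k)) / L = INR k).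
{ intros k; rewrite pow_INR, ln_pow by (apply b_pos; lia); unfold L; field; exact (Rgt_not_eq _ _ Lpos). }
rewrite !Hlog, S_INR in Main.
rewrite RInt_periodic in Main by assumption.
eapply Rle_lt_trans; [exact Main|].
replace (INR p + 1 - INR p) with 1 by ring; rewrite Rmult_1_r.
assert (Hbig : C / eps < INR (b ^ p)).
{ eapply Rlt_le_trans; [apply HN|]; rewrite <- S_INR; apply le_INR.
  apply Nat.le_trans with p; [exact HNp|]; apply Nat.lt_le_incl, Nat.pow_gt_lin_r; lia. }
assert (Hpos : 0 < INR (b ^ p)) by (apply lt_0_INR; lia).
apply Rmult_lt_reg_r with (INR (b ^ p)); [exact Hpos|].
unfold Rdiv; rewrite Rmult_assoc, Rinv_l, Rmult_1_r by lra.
apply Rmult_lt_compat_l with (r := eps) in Hbig; [|exact He].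
replace (eps * (C / eps)) with C in Hbig by (field; lra); exact Hbig.
Qed.

Theorem theorem1 (b : nat) (A : list nat) (s : C)
  (Hb : (2 <= b)%nat)
  (HAne : A <> [])
  (HAnd : NoDup A)
  (HAb : List.Forall (fun a => (a < b)%nat) A)
  (Hmax : fmax A = (b - 1)%nat)
  (Hs : Re s > ln (INR (List.length A)) / ln (INR b)) :
  exists F : R -> C,
    (* first expression of F_s(m) (Fourier series in log_b m) *)
    (forall m : R, 0 < m ->
       is_zsum (fun k : Z =>
         let w := (s - RtoC (2 * PI * IZR k / ln (INR b)) * Ci)%C in
         (RtoC (/ ln (INR b)) * cis (2 * PI * IZR k * (ln m / ln (INR b)))
            * CGamma w * sumB b A w)%C)
       (F m)) /\
    (* second expression of F_s(m) *)
    (forall m : R, 0 < m ->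
       exists S : C,
         is_zsum (fun j : Z =>
           (cpow (INR b) (RtoC (IZR j) * s)
            * RtoC (exp (- (powerRZ (INR b) j * m)))
            * RtoC (Series (fun n : nat =>
                 (indB b A n * exp (- (INR n * powerRZ (INR b) j * m)))%R)))%C) S
         /\ F m = (cpow m s * S)%C) /\
    (* F_s is 1-periodic in log_b m *)
    (forall m : R, 0 < m -> F (INR b * m) = F m) /\
    (* t |-> F_s(b^t) is smooth *)
    (forall (n : nat) (t : R),
       ex_derive_n (fun t => Re (F (Rpower (INR b) t))) n t /\
       ex_derive_n (fun t => Im (F (Rpower (INR b) t))) n t) /\
    (* m^s u_m(s) = F_s(m) + O(1/m) as m -> +oo *)
    (exists (K M : R), forall m : R, M <= m ->
       Cmod (cpow m s * umom b A s m - F m)%C <= K / m) /\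
    (* asymptotic average of integer moments *)
    filterlim
      (fun p : nat =>
         sum_n_m (fun mm : nat =>
           (cpow (INR mm) s * umom b A s (INR mm)
            * RtoC (ln (INR mm / (INR mm - 1)) / ln (INR b)))%C)
           (b ^ p + 1) (b ^ (S p)))
      eventually
      (locally (CGamma s * RtoC (/ ln (INR b)) * sumB b A s)%C).
Proof.
apply Rgt_lt in Hs.
assert (Lpos := ln_b_pos b Hb); assert (bpos := b_pos b Hb).
destruct (F_periodic b A s Hb HAnd HAb Hmax Hs) as [Pr Pi].
destruct (moment_asymptotics b A s Hb HAnd HAb Hmax Hs) as [K [HK HA]].
exists (fun m => (Fre b A s (ln m / ln (INR b)), Fim b A s (ln m / ln (INR b)))).
split; [|split; [|split; [|split; [|split]]]].
- intros m _; exact (F_fourier b A s Hb HAnd HAb Hmax Hs (ln m / ln (INR b))).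
- intros m Hm; exact (F_second b A s Hb HAnd HAb Hmax Hs m Hm).
- intros m Hm; rewrite ln_mult by assumption.
  replace ((ln (INR b) + ln m) / ln (INR b)) with (ln m / ln (INR b) + 1) by (field; lra).
  now rewrite Pr, Pi.
- intros n t.
  assert (E : forall u, ln (Rpower (INR b) u) / ln (INR b) = u).
  { intros u; unfold Rpower; rewrite ln_exp; field; lra. }
  destruct (F_smooth b A s Hb HAnd HAb Hmax Hs n t) as [D1 D2].
  split; [apply ex_derive_n_ext with (Fre b A s)|apply ex_derive_n_ext with (Fim b A s)];
    trivial; intros u; simpl; now rewrite E.
(* The modulus is at most sqrt 2 times the larger component, whence the factor 2. *)
- exists (2 * K), 1; intros m Hm; destruct (HA m Hm) as [H1 H2].
  eapply Rle_trans; [apply Cmod_2Rmax|].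
  set (D := (cpow m s * umom b A s m - _)%C).
  assert (B : Rmax (Rabs (fst D)) (Rabs (snd D)) <= K / m) by (apply Rmax_lub; [exact H1|exact H2]).
  assert (S2 : sqrt 2 <= 2).
  { rewrite <- (sqrt_square 2) at 2 by lra; apply sqrt_le_1; lra. }
  assert (0 <= Rmax (Rabs (fst D)) (Rabs (snd D)))
    by (eapply Rle_trans; [apply Rabs_pos|apply Rmax_l]).
  unfold Rdiv in *; rewrite Rmult_assoc.
  apply Rmult_le_compat; trivial; apply sqrt_pos.
- assert (EM : (CGamma s * RtoC (/ ln (INR b)) * sumB b A s)%C =
     (RInt (Fre b A s) 0 1, RInt (Fim b A s) 0 1)).
  { rewrite <- F_mean by assumption; ring. }
  rewrite EM; clear EM.
  destruct (F_lipschitz b A s Hb HAnd HAb Hmax Hs) as [Lip HL].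
  assert (HA' : forall m, (1 <= m)%nat ->
    Rabs (Re (cpow (INR m) s * umom b A s (INR m)) - Fre b A s (ln (INR m) / ln (INR b))) <= K / INR m /\
    Rabs (Im (cpow (INR m) s * umom b A s (INR m)) - Fim b A s (ln (INR m) / ln (INR b))) <= K / INR m).
  { intros m Hm; apply HA; change 1 with (INR 1); now apply le_INR. }
  assert (Cr : cont (Fre b A s)) by (apply Per_cont; now apply profile_cos_expdec).
  assert (Cm : cont (Fim b A s)) by (apply Per_cont; now apply profile_sin_expdec).
  apply filterlim_C; intros eps He.
  destruct (log_average b _ _ K Lip Hb Cr Pr HK (fun u v => proj1 (HL u v)) (fun m Hm => proj1 (HA' m Hm)) eps He)
    as [N1 HN1].
  destruct (log_average b _ _ K Lip Hb Cm Pi HK (fun u v => proj2 (HL u v)) (fun m Hm => proj2 (HA' m Hm)) eps He)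
    as [N2 HN2].
  exists (N1 + N2)%nat; intros p Hp.
  specialize (HN1 p ltac:(lia)); specialize (HN2 p ltac:(lia)).
  assert (Hle : (b ^ p <= b ^ S p)%nat) by (apply Nat.pow_le_mono_r; lia).
  (* The difference counts the integers m with b^p < m <= b^(p + 1), the number of terms that
     [sum_n_m_C] expects. *)
  replace (b ^ S p)%nat with (b ^ p + (b ^ S p - b ^ p))%nat at 1 2 by lia.
  rewrite sum_n_m_C; simpl Re; simpl Im.
  split.
  + erewrite nsum_ext; [exact HN1|].
    intros i _; cbv beta; simpl; ring.
  + erewrite nsum_ext; [exact HN2|].
    intros i _; cbv beta; simpl; ring.
Qed.
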